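(* Let $A\in\mathbb{R}^{d\times d}$ be a symmetric banded matrix with half-bandwidth $m\ge 1$, i.e. $A_{i,j}=0$ whenever $|i-j|>m$. For all integers $n\ge 1$ and $s\ge 0$, and all indices $i,j\in\{1,\dots,d\}$ with $|i-j|>2mn$, it holds $$|[\psi_1(A)]_{i,j}|\le |[r_{n,s}(A)]_{i,j}|+|[\varepsilon_{n,s}(A)]_{i,j}|,$$ where $$|[r_{n,s}(A)]_{i,j}|\le\left\|\frac{A}{2\pi}\right\|_2^{2(n+1)}\sum_{\nu=j-2m(n+1)}^{j+2m(n+1)}\ \sum_{k=1}^s\frac{C_k}{k^{2n}}\lambda_k^{|i-\nu|}$$ (the sum over $\nu$ being restricted to $1\le\nu\le d$) and $$|[\varepsilon_{n,s}(A)]_{i,j}|\le\left\|\frac{A}{2\pi}\right\|_2^{2(n+1)}\left(\zeta(2n+2)-\sum_{k=1}^s\frac{1}{k^{2n+2}}\right).$$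
   Context: The function $\psi_1$ is $\psi_1(z)=\dfrac{z}{e^z-1}$, with $\psi_1(0)=1$. For integers $n,s$ define $$p_n(z)=1-\frac12 z+\sum_{i=0}^{n-1}z^{2(i+1)}\frac{B_{2(i+1)}}{(2(i+1))!},\qquad r_{n,s}(z)=2(-1)^n\left(\frac{z}{2\pi}\right)^{2(n+1)}\sum_{k=1}^s\frac{1}{k^{2n}\left(\left(\frac{z}{2\pi}\right)^2+k^2\right)},$$ $$\varepsilon_{n,s}(z)=\psi_1(z)-p_n(z)-r_{n,s}(z),$$ where $B_k$ are the Bernoulli numbers, given by $\frac{z}{e^z-1}=\sum_{k\ge0}B_k\frac{z^k}{k!}$ for $|z|<2\pi$. These functions are applied to the symmetric matrix $A$ as matrix functions. With $\rho(A)$ the spectral radius of $A$, for $k\ge1$ set $$a_k=k^2,\quad b_k=\left(\frac{\rho(A)}{2\pi}\right)^2+k^2,\quad r_k=\frac{b_k}{a_k},$$ $$\lambda_k=\left(\frac{\sqrt{r_k}-1}{\sqrt{r_k}+1}\right)^{1/(2m)},\qquad C_k=\max\left\{a_k^{-1},\ \frac{(1+\sqrt{r_k})^2}{2a_kr_k}\right\}.$$ $\|\cdot\|_2$ is the spectral norm and $\zeta$ is the Riemann zeta function. Empty sums are zero and $0^0=1$. *)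

(* Defs.v *)
From HB Require Import structures.
From mathcomp Require Import all_boot all_order all_algebra.
From mathcomp Require Import all_classical all_reals all_analysis.
From mathcomp Require Import complex.

Set Implicit Arguments.
Unset Strict Implicit.
Unset Printing Implicit Defensive.

Import Order.TTheory GRing.Theory Num.Theory.
Import numFieldTopology.Exports numFieldNormedType.Exports.

Local Open Scope classical_set_scope.
Local Open Scope ring_scope.

Section ScalarFunctions.
Variable R : realType.
Implicit Types (z : R) (n s k : nat).

Definition psi1 z : R := if z == 0 then 1 else z / (expR z - 1).

(* The coefficients of a convergent power series are unique, so this is the
   sequence of Bernoulli numbers (with B_1 = -1/2); restricting the generating
   function to real arguments does not change its coefficients. *)
Definition bernoulli_num : R^nat :=
  xget (fun=> 0) [set B : R^nat | forall z, `|z| < 2 * pi ->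
    pseries (fun k => B k / k`!%:R) z @ \oo --> psi1 z].

Definition p_trunc n z : R :=
  1 - 2^-1 * z +
  \sum_(0 <= i < n)
    z ^+ (2 * i.+1) * (bernoulli_num (2 * i.+1) / (2 * i.+1)`!%:R).

Definition r_rat n s z : R :=
  2 * (-1) ^+ n * (z / (2 * pi)) ^+ (2 * n.+1) *
  \sum_(1 <= k < s.+1)
    (k%:R ^+ (2 * n) * ((z / (2 * pi)) ^+ 2 + k%:R ^+ 2))^-1.

Definition eps_rem n s z : R := psi1 z - p_trunc n z - r_rat n s z.

(* riemannR is indexed from 0, with n-th term 1 / (n + 1) `^ a. *)
Definition zeta (a : R) : R := limn (series (riemannR a)).

End ScalarFunctions.
Arguments bernoulli_num {R}.

Section Matrices.
Variables (R : realType) (d : nat).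
Implicit Type A : 'M[R]_d.

Definition banded (m : nat) A : Prop :=
  forall i j : 'I_d, (m < `|i - j|)%N -> A i j = 0.

(* P diag(f(D)) P^-1 does not depend on the chosen diagonalization
   A = P diag(D) P^-1, and one exists whenever A is symmetric. The default
   value 0 is only taken when A is not diagonalizable over R. *)
Definition mxfun (f : R -> R) A : 'M[R]_d :=
  xget 0 [set B : 'M[R]_d | exists (P : 'M[R]_d) (D : 'rV[R]_d),
    [/\ P \in unitmx,
        A = P *m diag_mx D *m invmx P &
        B = P *m diag_mx (map_mx f D) *m invmx P]].

Definition spectral_radius A : R :=
  sup [set ComplexField.Normc.normc z |
        z in [set z : R[i] | eigenvalue (map_mx (real_complex R) A) z]].

Definition norm2 (x : 'cV[R]_d) : R := Num.sqrt (\sum_(i < d) x i 0 ^+ 2).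

Definition spectral_norm A : R :=
  sup [set norm2 (A *m x) | x in [set x : 'cV[R]_d | norm2 x <= 1]].

End Matrices.

Section Constants.
Variables (R : realType) (d : nat) (A : 'M[R]_d).
Implicit Types k m : nat.

Definition a_ k : R := k%:R ^+ 2.
Definition b_ k : R := (spectral_radius A / (2 * pi)) ^+ 2 + k%:R ^+ 2.
Definition ratio k : R := b_ k / a_ k.

Definition lambda_ m k : R :=
  ((Num.sqrt (ratio k) - 1) / (Num.sqrt (ratio k) + 1)) `^ ((2 * m)%:R^-1).

Definition C_ k : R :=
  Num.max (a_ k)^-1
          ((1 + Num.sqrt (ratio k)) ^+ 2 / (2 * a_ k * ratio k)).

End Constants.

(* Main.v *)
Require Import Defs.
From mathcomp Require Import all_boot all_order all_algebra.
From mathcomp Require Import all_classical all_reals all_analysis.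
From mathcomp Require Import complex ring lra zify.

Set Implicit Arguments.
Unset Strict Implicit.
Unset Printing Implicit Defensive.

Import Order.TTheory GRing.Theory Num.Theory.
Import numFieldTopology.Exports numFieldNormedType.Exports.
Local Open Scope classical_set_scope.
Local Open Scope ring_scope.

(** Write A = P diag(D) P^T with P orthogonal, so that f(A)_{ij} is the sum over
    l of P_{il} f(D_l) P_{jl} ([symmetric_orthogonal_diagonalization],
    [mxfun_spectral_calculus]). Every estimate on an entry of f(A) is then an
    estimate on the values of f at the eigenvalues of A.

    The first inequality is the triangle inequality for
    psi_1 = p_n + r_{n,s} + eps_{n,s}: the polynomial p_n has degree 2n, so
    p_n(A) has half-bandwidth 2mn and its entry at (i, j) vanishes.

    For the remainder, put w = (z / 2pi)^2. The partial fraction expansion of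
    the hyperbolic cotangent reads
      psi_1(z) + z/2 - 1 = sum over k >= 1 of 2 w / (w + k^2)
    ([psi1_partial_cvg]). Expanding each fraction into n terms of a geometric
    sum produces the terms of p_n of degree at least 2, once the Bernoulli numbers
    have been identified with zeta values ([bernoulli_numE]), and the remainder
      2 (-1)^n w^{n+1} times the sum over k of 1 / (k^{2n} (w + k^2)),
    whose first s terms are r_{n,s}. Hence (-1)^n eps_{n,s} lies between 0 and
    2 w^{n+1} (zeta(2n+2) - sum_{k<=s} k^{-2n-2}) ([eps_rem_bounds]). The factor
    2 is absent from the final estimate because an off-diagonal entry of a
    symmetric matrix with spectrum in [0, M] is at most M/2: subtracting M/2
    times the identity does not change the entry and leaves a matrix of norm at
    most M/2 ([spectral_calculus_offdiag_le]).

    For r_{n,s}(A) = 2 (-1)^n X Y with X = (A / 2pi)^{2(n+1)}, the entries of the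
    inverses ((A / 2pi)^2 + k^2)^{-1} that make up Y decay like C_k lambda_k^e at
    distance e from the diagonal, by the argument of Demko, Moss and Smith: a
    polynomial of degree N in a matrix of half-bandwidth 2m vanishes at
    distances above 2mN, so the entry is bounded by the error of the best
    polynomial approximation of 1/t on [a_k, b_k]
    ([inv_poly_approx], [shifted_inverse_decay]). Since X is banded, only the
    stated window of indices contributes. The factor 2 is again absorbed by the
    positivity of X: row j of X - M/2 has Euclidean norm at most M/2, where M is
    the norm of X, so the off-diagonal entries of the row are at most M/2, and
    the excess of the diagonal one is paid for by the two neighbours of j on the
    side of i, at which the decay bound is at least as large as at j
    ([row_weighted_sum_le]). *)

(** * Orthogonal diagonalization of real symmetric matrices *)

Lemma mulmx_tr_ge0 (R : realDomainType) n (v : 'rV[R]_n) : 0 <= (v *m v^T) 0 0.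
Proof.
by rewrite mxE sumr_ge0 // => k _; rewrite mxE -expr2 sqr_ge0.
Qed.

Lemma mulmx_tr_eq0 (R : realDomainType) n (v : 'rV[R]_n) :
  ((v *m v^T) 0 0 == 0) = (v == 0).
Proof.
apply/idP/eqP => [|->]; last by rewrite mul0mx mxE.
rewrite mxE psumr_eq0 => [/allP v0|k _]; last by rewrite mxE -expr2 sqr_ge0.
apply/rowP => k; have := v0 k (mem_index_enum _).
by rewrite !mxE -expr2 sqrf_eq0 => /eqP.
Qed.

(** A complex eigenvector x + iy for a + ib gives x A = a x - b y and
    y A = a y + b x; comparing the two values of x A y^T yields
    b (|x|^2 + |y|^2) = 0, so the eigenvalue is real and x or y is a real
    eigenvector. *)
Lemma symmetric_eigenvector (R : rcfType) n (A : 'M[R]_n.+1) : A^T = A ->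
  exists (l : R) (v : 'rV_n.+1), v != 0 /\ v *m A = l *: v.
Proof.
move=> As; have [[a b] /eigenvalueP [w wA w0]] :=
  Theorem7' (map_mx (real_complex R) A) isT.
pose x := map_mx (@complex.Re R) w; pose y := map_mx (@complex.Im R) w.
have ReD : {morph @complex.Re R : u v / u + v} by case=> ? ? [].
have ImD : {morph @complex.Im R : u v / u + v} by case=> ? ? [].
have xA : x *m A = a *: x - b *: y.
  apply/rowP => j; have := congr1 (fun u : 'rV[R[i]]_n.+1 => complex.Re (u 0 j)) wA.
  rewrite !mxE (big_morph _ ReD (erefl _)).
  under eq_bigr do rewrite !mxE.
  rewrite [in RHS]/=; case: (w 0 j) => p q /= <-; apply: eq_bigr => k _.
  by rewrite !mxE; case: (w 0 k) => r t /=; rewrite mulr0 subr0.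
have yA : y *m A = a *: y + b *: x.
  apply/rowP => j; have := congr1 (fun u : 'rV[R[i]]_n.+1 => complex.Im (u 0 j)) wA.
  rewrite !mxE (big_morph _ ImD (erefl _)).
  under eq_bigr do rewrite !mxE.
  rewrite [in RHS]/=; case: (w 0 j) => p q /= <-; apply: eq_bigr => k _.
  by rewrite !mxE; case: (w 0 k) => r t /=; rewrite mulr0 add0r.
have b0 : b = 0 \/ (x = 0 /\ y = 0).
  have E : (x *m A) *m y^T = (x *m (y *m A)^T) by rewrite trmx_mul As mulmxA.
  move: E; rewrite xA yA mulmxBl linearD /= !linearZ /= mulmxDr.
  rewrite -!scalemxAl -!scalemxAr => /addrI/eqP.
  rewrite eq_sym -addr_eq0 -scalerDr scaler_eq0.
  move=> /orP[/eqP b0|/eqP E]; [by left|right].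
  have /eqP : (x *m x^T) 0 0 + (y *m y^T) 0 0 = 0.
    by move: (congr1 (fun M : 'M[R]_1 => M 0 0) E); rewrite [LHS]mxE [RHS]mxE.
  rewrite paddr_eq0 ?mulmx_tr_ge0 // !mulmx_tr_eq0.
  by move=> /andP[/eqP-> /eqP->].
have xy0 : ~ (x = 0 /\ y = 0).
  move=> [x0 y0]; case/eqP: w0; apply/rowP => j.
  have := congr1 (fun u : 'rV[R]_n.+1 => u 0 j) x0.
  have := congr1 (fun u : 'rV[R]_n.+1 => u 0 j) y0.
  by rewrite !mxE; case: (w 0 j) => p q /= -> ->.
case: b0 => [b0|//]; move: xA yA; rewrite b0 !scale0r subr0 addr0 => xA yA.
exists a; have [x0|x0] := eqVneq x 0; last by exists x.
by exists y; split => //; apply/eqP => y0; apply: xy0.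
Qed.

(** The Householder reflection that exchanges v and the first basis vector is
    symmetric, orthogonal, and has v as its first row. *)
Lemma unit_row_orthogonal_completion (R : rcfType) n (v : 'rV[R]_n.+1) :
  v *m v^T = 1%:M ->
  exists Q : 'M[R]_n.+1, [/\ Q^T = Q, Q *m Q = 1%:M & row 0 Q = v].
Proof.
move=> v1; pose e : 'rV[R]_n.+1 := delta_mx 0 0.
have e1 : e *m e^T = 1%:M.
  rewrite trmx_delta mul_delta_mx.
  by apply/matrixP => i j; rewrite !mxE !ord1.
have [ve|ve] := eqVneq v e.
  exists 1%:M; rewrite trmx1 mulmx1; split=> //; rewrite ve.
  by apply/rowP => j; rewrite !mxE eq_sym.
pose w := v - e; pose c := v 0 0.
have ev : e *m v^T = c%:M.
  by apply/matrixP => i j; rewrite -rowE !mxE !ord1 eqxx.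
have vE : v *m e^T = c%:M by rewrite -[LHS]trmxK trmx_mul trmxK ev tr_scalar_mx.
have ww : w *m w^T = (2 * (1 - c))%:M.
  rewrite linearB /= mulmxBl !mulmxBr v1 e1 ev vE -!(raddfB (scalar_mx (n:=1))) /=.
  by congr (_%:M); ring.
have ew : e *m w^T = (c - 1)%:M.
  by rewrite linearB /= mulmxBr ev e1 -raddfB.
have c0 : 1 - c != 0.
  apply: contra_neq ve => c0; apply/eqP; rewrite -subr_eq0 -mulmx_tr_eq0 -/w.
  by rewrite ww c0 mulr0 mxE.
pose k := (1 - c)^-1; exists (1%:M - k *: (w^T *m w)); split.
- by rewrite linearB /= linearZ /= trmx_mul trmxK trmx1.
- have WW : (w^T *m w) *m (w^T *m w) = (2 * (1 - c)) *: (w^T *m w).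
    by rewrite mulmxA -(mulmxA w^T) ww mul_mx_scalar -scalemxAl.
  move: (w^T *m w) WW => W WW.
  rewrite mulmxBl !mulmxBr !mul1mx mulmx1 -scalemxAr -scalemxAl WW !scalerA.
  have -> : k * k * (2 * (1 - c)) = k + k by rewrite /k; field.
  by rewrite scalerDl opprB addrK subrK.
- rewrite rowE -/e [LHS]mulmxBr mulmx1 -scalemxAr mulmxA ew mul_scalar_mx scalerA.
  have -> : k * (c - 1) = -1 by rewrite /k; field.
  by rewrite scaleN1r opprK addrC subrK.
Qed.

(** Deflation: conjugating A by the reflection attached to a unit eigenvector
    splits off the eigenvalue and leaves a smaller symmetric block. *)
Theorem symmetric_orthogonal_diagonalization (R : rcfType) n (A : 'M[R]_n) :
  A^T = A -> exists (P : 'M[R]_n) (D : 'rV[R]_n),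
    P *m P^T = 1%:M /\ A = P *m diag_mx D *m P^T.
Proof.
elim: n A => [|n IHn] A As.
  by exists 1%:M, 0; split; apply/matrixP => -[].
have [l [u [u0 uA]]] := symmetric_eigenvector As.
pose N := Num.sqrt ((u *m u^T) 0 0).
have N0 : N != 0 by rewrite sqrtr_eq0 -ltNge lt0r mulmx_tr_eq0 u0 mulmx_tr_ge0.
pose v := N^-1 *: u.
have v1 : v *m v^T = 1%:M.
  rewrite linearZ /= -scalemxAl -scalemxAr scalerA -invfM -expr2.
  rewrite sqr_sqrtr ?mulmx_tr_ge0 // [X in _ *: X]mx11_scalar scale_scalar_mx mulVf //.
  by rewrite mulmx_tr_eq0.
have vA : v *m A = l *: v by rewrite -scalemxAl uA !scalerA mulrC.
have [Q [Qs QQ Qv]] := unit_row_orthogonal_completion v1.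
pose e : 'rV[R]_n.+1 := delta_mx 0 0.
pose B : 'M[R]_(1 + n) := Q *m A *m Q.
have Bs : B^T = B by rewrite /B !trmx_mul As Qs mulmxA.
have eB : e *m B = l *: e.
  rewrite /B !mulmxA -rowE Qv vA -scalemxAl.
  by rewrite -Qv rowE -mulmxA QQ mulmx1.
have QAQ : Q *m A *m Q = B by [].
clearbody B.
have B0 j : B (lshift n 0) j = l * (j == lshift n 0)%:R.
  have := congr1 (fun M : 'rV[R]_n.+1 => M 0 j) eB.
  rewrite -rowE !mxE !eqxx /=.
  by have -> : lshift n 0 = 0 :> 'I_(1 + n) by apply: val_inj.
have B00 : ulsubmx B = l%:M.
  apply/matrixP => i j; rewrite !mxE !ord1 B0 eqxx.
  by rewrite mulr1 mulr1n.
have B01 : ursubmx B = 0.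
  apply/matrixP => i j; rewrite !mxE !ord1 B0 -val_eqE /=.
  by rewrite mulr0.
have B10 : dlsubmx B = 0 by rewrite -[B]Bs -trmx_ursub B01 trmx0.
have [|P [D [PP BE]]] := IHn (drsubmx B).
  by rewrite trmx_drsub Bs.
pose P1 : 'M[R]_(1 + n) := block_mx 1%:M 0 0 P.
have PP1 : P1 *m P1^T = 1%:M.
  rewrite /P1 tr_block_mx !trmx0 trmx1 mulmx_block.
  by rewrite !mul0mx !mulmx0 mulmx1 !addr0 add0r PP -scalar_mx_block.
pose D1 : 'rV[R]_(1 + n) := row_mx l%:M D.
have BE1 : B = P1 *m diag_mx D1 *m P1^T.
  rewrite -[LHS]submxK B00 B01 B10 BE diag_mx_row /P1 tr_block_mx.
  rewrite !trmx0 trmx1 !mulmx_block !mul0mx !mulmx0 !mulmx1 !mul1mx !addr0 !add0r.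
  congr block_mx; rewrite ?mul0mx //.
  by apply/matrixP => i j; rewrite !mxE !ord1 eqxx !mulr1n.
exists (Q *m P1), D1; rewrite trmx_mul Qs; split.
  by rewrite mulmxA -(mulmxA Q) PP1 mulmx1.
by rewrite !mulmxA -!(mulmxA Q) -BE1 -QAQ !mulmxA QQ mul1mx -mulmxA QQ mulmx1.
Qed.

(** * Functions of a diagonalized symmetric matrix *)

Lemma banded_mul (R : realType) d k l (B C : 'M[R]_d) :
  banded k B -> banded l C -> banded (k + l) (B *m C).
Proof.
move=> Bb Cb i j hij; rewrite mxE big1 // => nu _.
have [h|h] := ltnP k `|i - nu|; first by rewrite Bb // mul0r.
rewrite Cb ?mulr0 //.
have h2 := leqD_dist i nu j.
rewrite -(ltn_add2l k); apply: leq_trans hij (leq_trans h2 _).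
by rewrite leq_add2r.
Qed.

Section OrthogonalDiagonalization.
Variables (R : realType) (d : nat) (P : 'M[R]_d) (D : 'rV[R]_d).
Hypothesis PPT : P *m P^T = 1%:M.
Implicit Types (f g : R -> R) (i j : 'I_d).

Let PTP : P^T *m P = 1%:M. Proof. exact: mulmx1C. Qed.
Let Pu : P \in unitmx. Proof. by case/mulmx1_unit: PPT. Qed.
Let invP : invmx P = P^T.
Proof. by rewrite -[RHS](mulKmx Pu) PPT mulmx1. Qed.

(** With f = id this is the matrix P diag(D) P^T itself, which allows the
    hypotheses on that matrix to be stated on the same footing as f(A). *)
Definition spectral_calculus f : 'M[R]_d := P *m diag_mx (map_mx f D) *m P^T.

Local Notation F := spectral_calculus.

Lemma spectral_calculusE f i j :
  F f i j = \sum_l P i l * f (D 0 l) * P j l.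
Proof.
rewrite mxE; apply: eq_bigr => l _; rewrite mul_mx_diag !mxE.
by [].
Qed.

(** The value does not depend on the diagonalization: if P' diag(D') P'^-1 is
    another one, the transition matrix S satisfies D_i S_ij = S_ij D'_j, hence
    D_i = D'_j wherever S_ij is nonzero, and S also intertwines f(D) and
    f(D'). *)
Lemma mxfun_spectral_calculus f : mxfun f (F id) = F f.
Proof.
apply: xget_unique.
  by exists P, D; rewrite invP; split=> //; rewrite /F map_mx_id.
move=> B [P' [D' [P'u AE ->]]].
pose S := P^T *m P'.
have PS : P' = P *m S by rewrite mulmxA PPT mul1mx.
have DS : diag_mx D *m S = S *m diag_mx D'.
  have : F id *m P' = P' *m diag_mx D' by rewrite AE mulmxKV.
  rewrite /F map_mx_id // => /(congr1 (mulmx P^T)).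
  by rewrite !mulmxA PTP mul1mx -mulmxA.
have fS : diag_mx (map_mx f D) *m S = S *m diag_mx (map_mx f D').
  apply/matrixP => i j; have := congr1 (fun M : 'M[R]_d => M i j) DS.
  rewrite !(mul_diag_mx, mul_mx_diag) !mxE.
  have [->|S0] := eqVneq (\sum_j0 P^T i j0 * P' j0 j) 0; first by rewrite !(mul0r, mulr0).
  by rewrite [in RHS]mulrC => /(mulIf S0) ->; rewrite mulrC.
apply: (can_inj (mulmxK P'u)); rewrite mulmxKV // PS.
by rewrite -mulmxA -fS /F !mulmxA -(mulmxA _ P^T P) PTP mulmx1.
Qed.

Lemma spectral_calculusD f g : F (f \+ g) = F f + F g.
Proof.
apply/matrixP => i j; rewrite [RHS]mxE !spectral_calculusE -big_split.
by apply: eq_bigr => l _ /=; rewrite mulrDr mulrDl.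
Qed.

Lemma spectral_calculusZ c f : F (fun t => c * f t) = c *: F f.
Proof.
apply/matrixP => i j; rewrite [RHS]mxE !spectral_calculusE mulr_sumr.
by apply: eq_bigr => l _ /=; rewrite mulrCA !mulrA.
Qed.

Lemma spectral_calculus_cst c : F (fun=> c) = c%:M.
Proof.
rewrite /F; have -> : map_mx (fun=> c) D = const_mx c.
  by apply/rowP => l; rewrite !mxE.
by rewrite diag_const_mx mul_mx_scalar -scalemxAl PPT scalemx1.
Qed.

Lemma spectral_calculusM f g : F (f \* g) = F f *m F g.
Proof.
rewrite /F !mulmxA -(mulmxA _ P^T P) PTP mulmx1 -[in RHS](mulmxA P (diag_mx _)) mulmx_diag.
by congr (_ *m diag_mx _ *m _); apply/rowP => l; rewrite !mxE.
Qed.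

Lemma spectral_calculus_sym f i j : F f i j = F f j i.
Proof.
by rewrite !spectral_calculusE; apply: eq_bigr => l _; rewrite mulrC mulrA mulrAC.
Qed.

Lemma row_sqr1 i : \sum_l P i l ^+ 2 = 1.
Proof.
have <- : (P *m P^T) i i = 1 by rewrite PPT mxE eqxx.
by rewrite mxE; apply: eq_bigr => l _; rewrite mxE expr2.
Qed.

(** The weights P_il P_jl have absolute values that sum to at most 1, because
    the rows of P are unit vectors. *)
Lemma spectral_calculus_le f M i j :
  (forall l, `|f (D 0 l)| <= M) -> `|F f i j| <= M.
Proof.
move=> fM; rewrite spectral_calculusE; apply: le_trans (ler_norm_sum _ _ _) _.
have -> : M = \sum_l M * ((P i l ^+ 2 + P j l ^+ 2) / 2).
  by rewrite -mulr_sumr -mulr_suml big_split /= !row_sqr1; field.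
apply: ler_sum => l _; rewrite mulrAC mulrC normrM.
apply: ler_pM => //; rewrite normrM -(real_normK (num_real (P i l))).
rewrite -(real_normK (num_real (P j l))).
rewrite ler_pdivlMr // -subr_ge0.
have -> : `|P i l| ^+ 2 + `|P j l| ^+ 2 - `|P i l| * `|P j l| * 2
  = (`|P i l| - `|P j l|) ^+ 2 by ring.
exact: sqr_ge0.
Qed.

(** Replacing f by f - M/2 leaves off-diagonal entries unchanged and halves the
    bound on the values. *)
Lemma spectral_calculus_offdiag_le f M i j : i != j ->
  (forall l, 0 <= f (D 0 l) <= M) -> `|F f i j| <= M / 2.
Proof.
move=> ij fM.
have -> : F f i j = F (f \+ (fun=> - (M / 2))) i j.
  by rewrite spectral_calculusD spectral_calculus_cst !mxE (negPf ij) mulr0n addr0.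
apply: spectral_calculus_le => l /=; rewrite ler_norml.
have /andP[h1 h2] := fM l; apply/andP; split; lra.
Qed.

(** The sum is the diagonal entry at j of f(A)^2. *)
Lemma spectral_calculus_row_sqr f M j :
  (forall l, `|f (D 0 l)| <= M) -> \sum_nu F f j nu ^+ 2 <= M ^+ 2.
Proof.
move=> fM.
have -> : \sum_nu F f j nu ^+ 2 = F (f \* f) j j.
  rewrite spectral_calculusM mxE; apply: eq_bigr => nu _.
  by rewrite expr2 [F f nu j]spectral_calculus_sym.
apply: le_trans (ler_norm _) _; apply: spectral_calculus_le => l /=.
by rewrite normrM -expr2 lerXn2r ?nnegrE // (le_trans _ (fM l)).
Qed.

Lemma spectral_calculus_poly_banded m (p : {poly R}) K :
  banded m (F id) -> (size p <= K.+1)%N -> banded (m * K) (F (horner p)).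
Proof.
move=> Ab; elim/poly_ind: p K => [|p c IHp] K szp i j hij.
  rewrite spectral_calculusE big1 // => l _.
  by rewrite horner0 mulr0 mul0r.
have -> : F (horner (p * 'X + c%:P)) = F (horner p) *m F id + c%:M.
  rewrite -spectral_calculusM -spectral_calculus_cst -spectral_calculusD.
  by congr F; apply/funext => t; rewrite !hornerE.
have ij : i != j by apply: contraTneq hij => ->; rewrite distnn.
rewrite [LHS]mxE [X in _ + X]mxE (negPf ij) mulr0n addr0.
have [->|p0] := eqVneq p 0.
  rewrite mxE big1 // => nu _; rewrite spectral_calculusE big1 ?mul0r // => l _.
  by rewrite horner0 mulr0 mul0r.
case: K => [|K] in szp hij *.
  by move: szp; rewrite size_MXaddC (negPf p0) /= ltnS leqn0 size_poly_eq0 (negPf p0).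
apply: (@banded_mul _ _ (m * K) m) => //; last by rewrite mulnS addnC in hij.
by apply: IHp; move: szp; rewrite size_MXaddC (negPf p0).
Qed.

End OrthogonalDiagonalization.

(** * Eigenvalues, spectral radius and spectral norm *)

Section SpectrumBounds.
Variables (R : realType) (d : nat) (P : 'M[R]_d) (D : 'rV[R]_d).
Hypothesis PPT : P *m P^T = 1%:M.

Lemma spectral_calculus_eigen l :
  spectral_calculus P D id *m col l P = D 0 l *: col l P.
Proof.
rewrite /spectral_calculus map_mx_id // -mulmxA colE (mulmxA P^T) (mulmx1C PPT).
rewrite mul1mx -mulmxA scalemxAr; congr (_ *m _).
apply/matrixP => i j; rewrite mul_diag_mx !mxE.
by case: eqVneq => [->|_] //; rewrite !mulr0.
Qed.

Lemma eigenvalue_le_spectral_radius l :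
  `|D 0 l| <= spectral_radius (spectral_calculus P D id).
Proof.
set A := spectral_calculus P D id; apply: ub_le_sup; last first.
  exists (real_complex R (D 0 l)).
    rewrite /= eigenvalue_map; apply/eigenvalueP.
    exists (col l P)^T.
      apply: trmx_inj; rewrite trmx_mul trmxK linearZ /= trmxK.
      have -> : A^T = A.
        by apply/matrixP => i j; rewrite mxE spectral_calculus_sym.
      exact: spectral_calculus_eigen.
    apply/eqP => /(congr1 (fun M => (M *m M^T) 0 0)).
    rewrite mul0mx trmxK !mxE; under eq_bigr do rewrite !mxE.
    have /mulmx1C := PPT => PTP.
    have : (P^T *m P) l l = 1 by rewrite PTP mxE eqxx.
    rewrite mxE => + h; under eq_bigr do rewrite mxE.
    by rewrite h => /eqP; rewrite eq_sym oner_eq0.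
  by rewrite /= expr0n addr0 sqrtr_sqr.
(* The supremum is over a bounded set: the eigenvalues are among the finitely
   many roots of the characteristic polynomial. *)
pose p := char_poly (map_mx (real_complex R) A).
have [rs pE] := closed_field_poly_normal p.
exists (\sum_(r <- rs) ComplexField.Normc.normc r) => _ [z /= zA <-].
have : z \in rs.
  move: zA; rewrite eigenvalue_root_char -/p pE.
  rewrite rootZ ?root_prod_XsubC // lead_coef_eq0 monic_neq0 //.
  exact: char_poly_monic.
move=> zrs; rewrite (big_rem _ zrs) /= lerDl sumr_ge0 // => -[u v] _.
exact: sqrtr_ge0.
Qed.

Lemma eigenvalue_le_spectral_norm l :
  `|D 0 l| <= spectral_norm (spectral_calculus P D id).
Proof.
set A := spectral_calculus P D id; apply: ub_le_sup; last first.
  have N1 : norm2 (col l P) = 1.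
    have : (P^T *m P) l l = 1 by rewrite (mulmx1C PPT) mxE eqxx.
    rewrite mxE /norm2 => E; rewrite -[RHS]sqrtr1 -E; congr Num.sqrt.
    by apply: eq_bigr => i _; rewrite !mxE expr2.
  exists (col l P); first by rewrite /= N1.
  rewrite spectral_calculus_eigen -[RHS]mulr1 -N1 /norm2 -sqrtr_sqr -sqrtrM ?sqr_ge0 //.
  by rewrite mulr_sumr; congr Num.sqrt; apply: eq_bigr => i _; rewrite mxE exprMn.
(* The entries of a vector of norm at most 1 are at most 1 in absolute value,
   so this constant bounds the set of which the norm is the supremum. *)
exists (Num.sqrt (\sum_i (\sum_j `|A i j|) ^+ 2)) => _ [x /= x1 <-].
apply: ler_wsqrtr; apply: ler_sum => i _.
rewrite -(real_normK (num_real (_ i 0))) lerXn2r ?nnegrE //.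
  by rewrite sumr_ge0.
rewrite mxE; apply: le_trans (ler_norm_sum _ _ _) _; apply: ler_sum => j _.
rewrite normrM ler_piMr // -sqrtr_sqr; apply: le_trans x1.
apply: ler_wsqrtr; rewrite (bigD1 j) //= lerDl sumr_ge0 // => k _.
exact: sqr_ge0.
Qed.

End SpectrumBounds.

(** * Partial fractions of the hyperbolic cotangent *)

(** Let c_n be the integral of cosh(xt) cos^n t over [0, pi/2], and s_n the
    integral of t sinh(xt) cos^n t, its derivative in x. Two integrations by
    parts give (x^2 + n^2) c_n = n (n-1) c_{n-2}; differentiating this in x gives
    the recurrence for s_n, and the quotient of the two is
      s_{n-2} / c_{n-2} = s_n / c_n + 2x / (x^2 + n^2).
    Starting from the explicit value at n = 0, which contains coth(pi x / 2),
    the partial fractions appear one at a time along even n. The remainder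
    s_n / c_n is at most x / n because t cos t <= sin t. *)

Section HalfPeriodIntegral.
Variable R : realType.
Implicit Types (f g F : R -> R) (x t : R) (n : nat).

Let mu := @lebesgue_measure R.

Definition int_quarter f : R := \int[mu]_(t in `[0, pi / 2]) f t.

Let integrable_quarter f : continuous f ->
  mu.-integrable `[0, pi / 2] (EFin \o f).
Proof.
move=> cf; apply: continuous_compact_integrable; first exact: segment_compact.
exact: continuous_subspaceT.
Qed.

(** All the integrals below are evaluated through explicit primitives, so this
    form of the fundamental theorem of calculus replaces integration by parts. *)
Lemma int_quarter_primitive F f : continuous f ->
  (forall t, is_derive t 1 F (f t)) -> int_quarter f = F (pi / 2) - F 0.
Proof.
move=> cf Ff; have dF t : derivable F t 1 by [].
have cF : continuous F.
  by move=> t; apply: differentiable_continuous; apply/derivable1_diffP.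
rewrite /int_quarter /Rintegral (@continuous_FTC2 _ _ F) //.
- by rewrite divr_gt0 // pi_gt0.
- exact: continuous_subspaceT.
- split=> //.
  + by apply: cvg_at_right_filter; exact: cF.
  + by apply: cvg_at_left_filter; exact: cF.
- by move=> t _; rewrite derive1E derive_val.
Qed.

Lemma int_quarter_lin a b f g : continuous f -> continuous g ->
  int_quarter (fun t => a * f t + b * g t) =
  a * int_quarter f + b * int_quarter g.
Proof.
move=> cf cg; have mI : measurable (`[0, pi / 2] : set (measurableTypeR R)).
  exact: measurable_itv.
have cZ (c : R) (h : R -> R) : continuous h -> continuous (fun t => c * h t).
  by move=> ch t; apply: cvgM; [exact: cvg_cst|exact: ch].
rewrite /int_quarter RintegralD //; try by apply: integrable_quarter; exact: cZ.
by rewrite !RintegralZl //; exact: integrable_quarter.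
Qed.

Lemma le_int_quarter f g : continuous f -> continuous g ->
  (forall t, 0 <= t <= pi / 2 -> f t <= g t) -> int_quarter f <= int_quarter g.
Proof.
by move=> cf cg fg; apply: le_Rintegral => //; try exact: integrable_quarter.
Qed.

Definition ch x t : R := (expR (x * t) + expR (- x * t)) / 2.
Definition sh x t : R := (expR (x * t) - expR (- x * t)) / 2.

(* The rules of derivation for pointwise expressions: they let the derivative
   of a formula be built as a term that follows its syntax. *)
Let dD t f g a b : is_derive t 1 f a -> is_derive t 1 g b ->
  is_derive t 1 (fun t => f t + g t) (a + b).
Proof. move=> fa gb; exact: (@is_deriveD _ _ _ f g). Qed.

Let dM t f g a b : is_derive t 1 f a -> is_derive t 1 g b ->
  is_derive t 1 (fun t => f t * g t) (f t * b + g t * a).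
Proof. move=> fa gb; exact: (@is_deriveM _ _ f g). Qed.

Let dN t f a : is_derive t 1 f a -> is_derive t 1 (fun t => - f t) (- a).
Proof. by move=> fa; exact: (@is_deriveN _ _ _ f). Qed.

Let dC t c : is_derive t 1 (fun=> c : R) 0.
Proof. exact: is_derive_cst. Qed.

Let dcos t n : is_derive t 1 (fun t => cos t ^+ n.+1)
  (- (n.+1%:R * cos t ^+ n * sin t)).
Proof.
have -> : (fun t => cos t ^+ n.+1) = (@cos R) ^+ n.+1 by rewrite exprfctE.
apply: is_derive_eq; rewrite /GRing.scale /=.
by rewrite mulrN.
Qed.

Let dexp c t : is_derive t 1 (fun t => expR (c * t)) (expR (c * t) * c).
Proof.
have E : is_derive t 1 (fun t => c * t) c.
  by apply: (is_derive_eq (dM (dC t c) (is_derive_id t 1))); rewrite mulr1 mulr0 addr0.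
exact: (@is_derive1_comp _ expR (fun t => c * t)).
Qed.

Lemma is_derive_ch x t : is_derive t 1 (ch x) (x * sh x t).
Proof.
apply: (is_derive_eq (dM (dD (dexp x t) (dexp (- x) t)) (dC t 2^-1))).
by rewrite /sh; ring.
Qed.

Lemma is_derive_sh x t : is_derive t 1 (sh x) (x * ch x t).
Proof.
apply: (is_derive_eq (dM (dD (dexp x t) (dN (dexp (- x) t))) (dC t 2^-1))).
by rewrite /ch; ring.
Qed.

Let cD f g : continuous f -> continuous g -> continuous (fun t => f t * g t).
Proof. by move=> cf cg t; apply: cvgM; [exact: cf|exact: cg]. Qed.

Let cpr F f : (forall t, is_derive t 1 F (f t)) -> continuous F.
Proof.
move=> Ff t; apply: differentiable_continuous; apply/derivable1_diffP.
by have := Ff t.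
Qed.

Let cch x : continuous (ch x). Proof. exact: cpr (is_derive_ch x). Qed.
Let csh x : continuous (sh x). Proof. exact: cpr (is_derive_sh x). Qed.
Let ccos n : continuous (fun t : R => cos t ^+ n).
Proof. by case: n => [|n]; [move=> t; exact: cvg_cst|exact: cpr (dcos ^~ n)]. Qed.
Let csin : continuous (@sin R). Proof. exact: continuous_sin. Qed.
Let cid : continuous (fun t : R => t). Proof. by move=> t; exact: cvg_id. Qed.

Definition cosh_moment x n : R :=
  int_quarter (fun t => ch x t * cos t ^+ n).
Definition sinh_moment x n : R :=
  int_quarter (fun t => t * sh x t * cos t ^+ n).

Let c_cosh_moment x n : continuous (fun t => ch x t * cos t ^+ n).
Proof. by apply: cD. Qed.
Let c_sinh_moment x n : continuous (fun t => t * sh x t * cos t ^+ n).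
Proof. by apply: cD => //; apply: cD. Qed.

(** The primitive G combines the two integrations by parts; it vanishes at both
    ends of the interval. *)
Lemma cosh_moment_rec x n :
  (x ^+ 2 + n.+2%:R ^+ 2) * cosh_moment x n.+2 = n.+2%:R * n.+1%:R * cosh_moment x n.
Proof.
apply/eqP; rewrite -subr_eq0 -mulNr -int_quarter_lin //.
pose G t := x * (sh x t * cos t ^+ n.+2) +
  n.+2%:R * (ch x t * (cos t ^+ n.+1 * sin t)).
rewrite (_ : int_quarter _ = G (pi / 2) - G 0).
  by rewrite /G cos_pihalf sin0 /sh !mulr0 !exprS; apply/eqP; ring.
apply: int_quarter_primitive => t.
  by apply: cvgD; (apply: cvgM; [exact: cvg_cst|exact: c_cosh_moment]).
apply: (is_derive_eq (dD
    (dM (dC t x) (dM (is_derive_sh x t) (dcos t n.+1)))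
    (dM (dC t n.+2%:R)
       (dM (is_derive_ch x t) (dM (dcos t n) (is_derive_sin t)))))).
have : sin t ^+ 2 = 1 - cos t ^+ 2 by rewrite -(cos2Dsin2 t); ring.
rewrite !(exprS (cos t)).
move: (cos t) (sin t) (ch x t) (sh x t) (cos t ^+ n) => c s C S cn E.
transitivity (- n.+2%:R * n.+1%:R * C * cn * s ^+ 2 +
  (n.+2%:R * C * c * cn * c + x ^+ 2 * C * c * c * cn)); first by ring.
by rewrite E; ring.
Qed.

(** Here G is the derivative in x of the primitive used for
    [cosh_moment_rec], so that no differentiation under the integral sign takes
    place. *)
Lemma sinh_moment_rec x n :
  2 * x * cosh_moment x n.+2 + (x ^+ 2 + n.+2%:R ^+ 2) * sinh_moment x n.+2 =
  n.+2%:R * n.+1%:R * sinh_moment x n.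
Proof.
apply/eqP; rewrite -subr_eq0.
pose f t := 2 * x * (ch x t * cos t ^+ n.+2) +
  (x ^+ 2 + n.+2%:R ^+ 2) * (t * sh x t * cos t ^+ n.+2).
have cf : continuous f.
  by move=> t; apply: cvgD; (apply: cvgM; first exact: cvg_cst);
    [exact: c_cosh_moment|exact: c_sinh_moment].
rewrite -int_quarter_lin // -[X in X - _]mul1r -mulNr -int_quarter_lin //.
pose G t := sh x t * cos t ^+ n.+2 + x * (t * ch x t * cos t ^+ n.+2) +
  n.+2%:R * (t * sh x t * (cos t ^+ n.+1 * sin t)).
rewrite (_ : int_quarter _ = G (pi / 2) - G 0).
  by rewrite /G cos_pihalf sin0 /sh !mulr0 !exprS expR0; apply/eqP; ring.
apply: int_quarter_primitive => t.
  by apply: cvgD; (apply: cvgM; first exact: cvg_cst);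
    [exact: cf|exact: c_sinh_moment].
apply: (is_derive_eq (dD (dD
    (dM (is_derive_sh x t) (dcos t n.+1))
    (dM (dC t x) (dM (dM (is_derive_id t 1) (is_derive_ch x t)) (dcos t n.+1))))
    (dM (dC t n.+2%:R)
       (dM (dM (is_derive_id t 1) (is_derive_sh x t))
           (dM (dcos t n) (is_derive_sin t)))))).
have : sin t ^+ 2 = 1 - cos t ^+ 2 by rewrite -(cos2Dsin2 t); ring.
rewrite /f !(exprS (cos t)).
move: (cos t) (sin t) (ch x t) (sh x t) (cos t ^+ n) => c s C S cn E.
rewrite /=.
transitivity (- n.+2%:R * n.+1%:R * t * S * cn * s ^+ 2 +
  (n.+2%:R * t * S * c * cn * c + x ^+ 2 * t * S * c * c * cn
   + 2 * x * C * c * c * cn)); first by ring.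
by rewrite E; ring.
Qed.
Lemma sh_ge0 x t : 0 <= x -> 0 <= t -> 0 <= sh x t.
Proof.
move=> x0 t0; rewrite divr_ge0 // subr_ge0 ler_expR mulNr.
by rewrite ge0_cp ?mulr_ge0.
Qed.

Lemma sh_gt0 x t : 0 < x -> 0 < t -> 0 < sh x t.
Proof.
move=> x0 t0; rewrite divr_gt0 // subr_gt0 ltr_expR mulNr.
by rewrite gt0_cp ?mulr_gt0.
Qed.

Let pihalf_gt0 : 0 < pi / 2 :> R.
Proof. by rewrite divr_gt0 // pi_gt0. Qed.

Lemma cosh_moment0 x : x * cosh_moment x 0 = sh x (pi / 2).
Proof.
rewrite -[LHS]addr0 -(mul0r (cosh_moment x 0)) -int_quarter_lin //.
rewrite (_ : int_quarter _ = sh x (pi / 2) - sh x 0).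
  by rewrite /sh !mulr0 subrr mul0r subr0.
apply: int_quarter_primitive => t.
  by apply: cvgD; (apply: cvgM; first exact: cvg_cst); exact: c_cosh_moment.
by apply: (is_derive_eq (is_derive_sh x t)); rewrite expr0; ring.
Qed.

Lemma sinh_moment0 x :
  x * sinh_moment x 0 + cosh_moment x 0 = pi / 2 * ch x (pi / 2).
Proof.
rewrite -[cosh_moment x 0]mul1r -int_quarter_lin //.
pose G t := t * ch x t.
rewrite (_ : int_quarter _ = G (pi / 2) - G 0); first by rewrite /G mul0r subr0.
apply: int_quarter_primitive => t.
  by apply: cvgD; (apply: cvgM; first exact: cvg_cst);
    [exact: c_sinh_moment|exact: c_cosh_moment].
apply: (is_derive_eq (dM (is_derive_id t 1) (is_derive_ch x t))).
by rewrite expr0; ring.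
Qed.

Lemma mul_cos_le_sin t : 0 <= t <= pi / 2 -> t * cos t <= sin t.
Proof.
move=> /andP[t0 tpi].
pose F t := sin t - t * cos t.
have dF (u : R) : is_derive u 1 F (u * sin u).
  apply: (is_derive_eq (dD (is_derive_sin u)
    (dN (dM (is_derive_id u 1) (is_derive_cos u))))).
  by rewrite /=; ring.
suff : F 0 <= F t by rewrite /F sin0 mul0r subr0 subr_ge0.
apply: (@ger0_derive1_le_cc _ F 0 (pi / 2)) => //.
- move=> u; rewrite in_itv /= => /andP[u0 upi].
  rewrite derive1E (@derive_val _ _ _ _ _ _ _ (dF u)) mulr_ge0 ?(ltW u0) //.
  apply: sin_ge0_pi; rewrite (ltW u0) /= (le_trans (ltW upi)) //.
  by rewrite ler_pdivrMr // ler_peMr ?pi_ge0 // ler1n.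
- by apply: continuous_subspaceT; exact: cpr dF.
- by rewrite in_itv /= lexx ltW.
- by rewrite in_itv /= t0.
Qed.

Lemma sinh_moment_ge0 x n : 0 <= x -> 0 <= sinh_moment x n.
Proof.
move=> x0; have <- : int_quarter (fun=> 0) = 0.
  by rewrite /int_quarter /Rintegral integral0.
apply: le_int_quarter => [t||t /andP[t0 tpi]]; [exact: cvg_cst|exact: c_sinh_moment|].
apply: mulr_ge0; first by rewrite mulr_ge0 ?sh_ge0.
rewrite exprn_ge0 // cos_ge0_pihalf // tpi andbT.
by rewrite (le_trans _ t0) // oppr_le0 ltW.
Qed.

(** Bounding t cos t by sin t makes the integrand sinh(xt) sin t cos^n t, which
    integrates by parts back to the integral of cosh(xt) cos^(n+1) t. *)
Lemma sinh_moment_le x n : 0 <= x ->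
  n.+1%:R * sinh_moment x n.+1 <= x * cosh_moment x n.+1.
Proof.
move=> x0; pose f t := sh x t * (sin t * cos t ^+ n).
have cf : continuous f by apply: cD => //; apply: cD.
have -> : x * cosh_moment x n.+1 = n.+1%:R * int_quarter f.
  apply/eqP; rewrite eq_sym -subr_eq0 -mulNr -int_quarter_lin //.
  pose G t := - (sh x t * cos t ^+ n.+1).
  rewrite (_ : int_quarter _ = G (pi / 2) - G 0).
    by rewrite /G cos_pihalf /sh !mulr0 !exprS; apply/eqP; ring.
  apply: int_quarter_primitive => t.
    by apply: cvgD; (apply: cvgM; first exact: cvg_cst);
      [exact: cf|exact: c_cosh_moment].
  apply: (is_derive_eq (dN (dM (is_derive_sh x t) (dcos t n)))).
  by rewrite /f exprS; ring.
rewrite ler_pM2l // le_int_quarter // => t tI; have /andP[t0 tpi] := tI.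
rewrite /f exprS; have cn : 0 <= cos t ^+ n.
  rewrite exprn_ge0 // cos_ge0_pihalf // tpi andbT.
  by rewrite (le_trans _ t0) // oppr_le0 ltW.
have -> : t * sh x t * (cos t * cos t ^+ n) = sh x t * (t * cos t * cos t ^+ n) by ring.
by rewrite ler_wpM2l ?sh_ge0 // ler_wpM2r // mul_cos_le_sin.
Qed.

Lemma cosh_moment_even_gt0 x N : 0 < x -> 0 < cosh_moment x N.*2.
Proof.
move=> x0; elim: N => [|N IH].
  by rewrite -(pmulr_rgt0 _ x0) cosh_moment0 sh_gt0.
have p : 0 < x ^+ 2 + N.*2.+2%:R ^+ 2 by rewrite addr_gt0 // exprn_gt0.
by rewrite doubleS -(pmulr_rgt0 _ p) cosh_moment_rec !mulr_gt0.
Qed.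

(** The left-hand side is (pi x / 2) coth(pi x / 2); the last summand is the
    remainder after N partial fractions, exact for every N. *)
Lemma coth_partial_sum x N : 0 < x ->
  x * (pi / 2) * ch x (pi / 2) / sh x (pi / 2) =
  1 + \sum_(1 <= k < N.+1) 2 * x ^+ 2 / (x ^+ 2 + k.*2%:R ^+ 2)
    + x * sinh_moment x N.*2 / cosh_moment x N.*2.
Proof.
move=> x0; have xN0 := lt0r_neq0 x0; elim: N => [|N IH].
  rewrite big_geq // addr0 double0 -cosh_moment0 -(mulrA x) -sinh_moment0.
  by field; rewrite xN0 lt0r_neq0 // (cosh_moment_even_gt0 0).
rewrite IH [in RHS]big_nat_recr //= doubleS -!addrA; congr (_ + (_ + _)).
pose n2 : R := N.*2.+2%:R; pose n1 : R := N.*2.+1%:R.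
have p : x ^+ 2 + N.*2.+2%:R ^+ 2 != 0 by rewrite lt0r_neq0 // addr_gt0 // exprn_gt0.
have j0 := lt0r_neq0 (cosh_moment_even_gt0 N x0).
have j1 := lt0r_neq0 (cosh_moment_even_gt0 N.+1 x0); rewrite doubleS in j1.
have c0 : n2 * n1 != 0 :> R by rewrite mulf_neq0 ?pnatr_eq0.
have -> : cosh_moment x N.*2 = (x ^+ 2 + n2 ^+ 2) * cosh_moment x N.*2.+2 / (n2 * n1).
  by rewrite cosh_moment_rec mulrAC divff // mul1r.
have -> : sinh_moment x N.*2 = (2 * x * cosh_moment x N.*2.+2 +
    (x ^+ 2 + n2 ^+ 2) * sinh_moment x N.*2.+2) / (n2 * n1).
  by rewrite sinh_moment_rec mulrAC divff // mul1r.
move: c0; rewrite mulf_eq0 negb_or => /andP[n20 n10].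
rewrite -/n2 in p *; move: (cosh_moment x N.*2.+2) (sinh_moment x N.*2.+2) j1 => Jn Kn j1.
by move: n1 n2 n10 n20 p => n1 n2 n10 n20 p; field; rewrite p n20 n10 j1.
Qed.
End HalfPeriodIntegral.

(** * The expansion of psi1 and its remainders *)

Section Psi1.
Variable R : realType.
Implicit Types (z w : R) (k n s N : nat).

Definition psi1_partial w N : R :=
  \sum_(1 <= k < N.+1) 2 * w / (w + k%:R ^+ 2).

(** Since psi1(z) + z/2 = (z/2) coth(z/2), the substitution x = z / pi gives the
    quantity expanded in [coth_partial_sum]. *)
Lemma psi1_coth z : 0 < z ->
  psi1 z + z / 2 =
  z / pi * (pi / 2) * ch (z / pi) (pi / 2) / sh (z / pi) (pi / 2).
Proof.
move=> z0; have p0 := lt0r_neq0 (@pi_gt0 R).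
rewrite /psi1 gt_eqF // /ch /sh.
have E : z / pi * (pi / 2) = z / 2 by rewrite mulrA divfK.
rewrite E mulNr E.
have -> : expR z = expR (z / 2) ^+ 2 by rewrite -expRM_natl; congr expR; field.
rewrite expRN.
have : 1 < expR (z / 2) by rewrite expR_gt1 divr_gt0.
move: (expR _) => u u1.
have u0 : u != 0 by rewrite gt_eqF // (lt_trans _ u1).
have u2 : u ^+ 2 - 1 != 0 by rewrite subr_eq0 gt_eqF // exprn_egt1.
by field; rewrite u0 u2.
Qed.

(** The parity of psi1(z) + z/2: it reduces the expansion to z > 0. *)
Lemma psi1N z : psi1 (- z) = psi1 z + z.
Proof.
rewrite /psi1 oppr_eq0; have [->|z0] := eqVneq z 0; first by rewrite addr0.
rewrite expRN.
have e0 : expR z != 0 by rewrite gt_eqF // expR_gt0.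
have e1 : expR z - 1 != 0 by rewrite subr_eq0 -(expR0 R) (inj_eq (@expR_inj R)).
have e2 : 1 - expR z != 0 by rewrite -opprB oppr_eq0.
by field; rewrite e1 e0 mulN1r e2.
Qed.

Lemma psi1_partial_cvg z :
  psi1_partial ((z / (2 * pi)) ^+ 2) @ \oo --> psi1 z + z / 2 - 1.
Proof.
wlog z0 : z / 0 < z => [H|].
  have [z0|z0|->] := ltgtP z 0; last 1 first.
  - rewrite /psi1 eqxx !mul0r expr0n /= addr0 subrr.
    have -> : psi1_partial 0 = cst 0; last exact: cvg_cst.
    apply/funext => N; rewrite /psi1_partial big1 // => k _.
    by rewrite mulr0 mul0r.
  - have := H (- z); rewrite oppr_gt0 => /(_ z0).
    rewrite mulNr sqrrN psi1N.
    by have -> : psi1 z + z + - z / 2 - 1 = psi1 z + z / 2 - 1 by field.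
  - exact: H.
pose x := z / pi.
have x0 : 0 < x by rewrite divr_gt0 // pi_gt0.
have E N : psi1 z + z / 2 - 1 - psi1_partial ((z / (2 * pi)) ^+ 2) N =
    x * sinh_moment x N.*2 / cosh_moment x N.*2.
  have -> : (z / (2 * pi)) ^+ 2 = x ^+ 2 / 4.
    by rewrite invfM mulrCA exprMn -/x mulrC exprVn; congr (_ / _); ring.
  have -> : psi1_partial (x ^+ 2 / 4) N =
      \sum_(1 <= k < N.+1) 2 * x ^+ 2 / (x ^+ 2 + k.*2%:R ^+ 2).
    apply: eq_big_nat => k /andP[k1 _].
    have h : x ^+ 2 + k.*2%:R ^+ 2 != 0.
      by rewrite lt0r_neq0 // addr_gt0 // ?exprn_gt0 // ltr0n double_gt0.
    rewrite -muln2 natrM in h *.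
    by field; exact: h.
  by rewrite psi1_coth // (coth_partial_sum N x0); ring.
have E0 N : 0 <= x * sinh_moment x N.*2 / cosh_moment x N.*2.
  rewrite divr_ge0 ?(ltW (cosh_moment_even_gt0 _ _)) //.
  by rewrite mulr_ge0 ?sinh_moment_ge0 // ltW.
have E1 N : x * sinh_moment x N.+1.*2 / cosh_moment x N.+1.*2 <= x ^+ 2 / N.+1%:R.
  rewrite ler_pdivrMr ?cosh_moment_even_gt0 // [leRHS]mulrAC ler_pdivlMr //.
  rewrite -[leLHS]mulrA expr2 -[leRHS]mulrA.
  rewrite ler_pM2l // mulrC doubleS; apply: le_trans (sinh_moment_le N.*2.+1 (ltW x0)).
  by rewrite ler_wpM2r ?sinh_moment_ge0 ?(ltW x0) // ler_nat; lia.
rewrite -cvg_shiftS; apply/cvgrPdist_le => e e0.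
have : x ^+ 2 * harmonic N @[N --> \oo] --> (x ^+ 2 * 0 : R).
  by apply: cvgM; [exact: cvg_cst|exact: cvg_harmonic].
rewrite mulr0 => /cvgrPdist_le/(_ e e0); apply: filterS => N.
rewrite sub0r normrN ger0_norm; last first.
  by apply: mulr_ge0; [exact: sqr_ge0|rewrite /harmonic invr_ge0].
by rewrite E ger0_norm //; apply: le_trans.
Qed.

Definition power_sum (p : nat) N : R := \sum_(1 <= k < N.+1) (k%:R ^+ p)^-1.

(** By comparison with the telescoping sum of 1/k - 1/(k+1). *)
Lemma power_sum_le2 p N : (1 < p)%N -> power_sum p N <= 2.
Proof.
move=> p1; suff H M : power_sum p M.+1 <= 2 - M.+1%:R^-1.
  case: N => [|N]; first by rewrite /power_sum big_geq.
  by apply: le_trans (H N) _; rewrite gerBl invr_ge0.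
elim: M => [|M IH].
  by rewrite /power_sum big_nat1 expr1n invr1; lra.
rewrite /power_sum big_nat_recr //=; apply: le_trans (lerD IH (lexx _)) _.
have : (M.+2%:R ^+ p)^-1 <= (M.+2%:R ^+ 2)^-1 :> R.
  by rewrite lef_pV2 ?posrE ?exprn_gt0 // ler_weXn2l // ler1n.
have : (M.+2%:R ^+ 2)^-1 <= M.+1%:R^-1 - M.+2%:R^-1 :> R.
  have -> : M.+1%:R^-1 - M.+2%:R^-1 = (M.+1%:R * M.+2%:R)^-1 :> R.
    have -> : M.+2%:R = M.+1%:R + 1 :> R by rewrite -[in LHS]addn1 natrD.
    have m0 : M.+1%:R != 0 :> R by rewrite pnatr_eq0.
    have m1 : M.+1%:R + 1 != 0 :> R by rewrite natr1 pnatr_eq0.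
    by move: (M.+1%:R) m0 m1 => y m0 m1; field; rewrite m0 m1.
  by rewrite lef_pV2 ?posrE ?mulr_gt0 // expr2 ler_pM2r // ler_nat.
move=> h1 h2; move: (le_trans h2 h1).
by move: (_ ^+ p)^-1 (M.+1%:R^-1) (M.+2%:R^-1) => u v w h; lra.
Qed.

Lemma power_sum_cvg p : (1 < p)%N -> power_sum p @ \oo --> zeta (p%:R : R).
Proof.
move=> p1; have E : power_sum p = series (riemannR p%:R).
  apply/funext => N; rewrite /power_sum /series /= big_add1 /=.
  by apply: eq_bigr => k _; rewrite /riemannR powR_mulrn.
rewrite /zeta -E; apply: nondecreasing_is_cvgn.
  by rewrite E; apply: nondecreasing_series => n _ _; exact/ltW/riemannR_gt0.
by exists 2 => _ [N _ <-]; exact: power_sum_le2.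
Qed.

(** The geometric identity
      w / (w + k^2) = sum_{i<n} (-1)^i (w/k^2)^{i+1}
                      + (-1)^n (w/k^2)^n w / (w + k^2),
    summed over k. *)
Lemma psi1_partial_expand w N n : 0 <= w ->
  psi1_partial w N =
  \sum_(0 <= i < n) 2 * (-1) ^+ i * w ^+ i.+1 * power_sum (2 * i + 2) N +
  2 * (-1) ^+ n * w ^+ n.+1 *
    \sum_(1 <= k < N.+1) (k%:R ^+ (2 * n) * (w + k%:R ^+ 2))^-1.
Proof.
move=> w0; elim: n => [|n IH].
  rewrite big_geq // add0r mulr_sumr; apply: eq_bigr => k _.
  by rewrite mulr1 expr1 mul1r.
rewrite IH [in RHS]big_nat_recr //= -addrA; congr (_ + _).
rewrite !mulr_sumr -big_split /=; apply: eq_big_nat => k /andP[k1 _].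
have k0 : k%:R != 0 :> R by rewrite pnatr_eq0 -lt0n.
have wk : w + k%:R ^+ 2 != 0 by rewrite lt0r_neq0 // ltr_wpDl // exprn_gt0 // ltr0n.
rewrite addn2 mulnS add2n !(exprS k%:R) !(exprS w) !(exprS (-1)).
have kn : k%:R ^+ (2 * n) != 0 :> R by rewrite expf_neq0.
by field; rewrite ?k0 ?wk ?kn.
Qed.

Definition tail_sum w n s N : R :=
  \sum_(s.+1 <= k < N.+1) (k%:R ^+ (2 * n) * (w + k%:R ^+ 2))^-1.

(** This is eps_rem with zeta values in place of Bernoulli numbers; the case
    s = 0 is what identifies the latter, so the two are compared only
    afterwards, in [eps_rem_bounds]. *)
Definition psi1_rem n s z : R :=
  psi1 z + z / 2 - 1
    - \sum_(0 <= i < n) 2 * (-1) ^+ i * ((z / (2 * pi)) ^+ 2) ^+ i.+1 *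
        zeta ((2 * i + 2)%:R : R)
    - 2 * (-1) ^+ n * ((z / (2 * pi)) ^+ 2) ^+ n.+1 *
      \sum_(1 <= k < s.+1)
        (k%:R ^+ (2 * n) * ((z / (2 * pi)) ^+ 2 + k%:R ^+ 2))^-1.

(** Up to the sign (-1)^n the remainder is the limit of a tail of positive terms,
    each at most 2 w^{n+1} / k^{2n+2}. *)
Lemma psi1_remainder_bounds n s z :
  0 <= (-1) ^+ n * psi1_rem n s z <=
    2 * ((z / (2 * pi)) ^+ 2) ^+ n.+1 *
      (zeta ((2 * n + 2)%:R : R) - power_sum (2 * n + 2) s).
Proof.
rewrite /psi1_rem; set w := _ ^+ 2; set e := _ - _ - _.
have w0 : 0 <= w by exact: sqr_ge0.
pose u N := (-1) ^+ n * (psi1_partial w N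
    - \sum_(0 <= i < n) 2 * (-1) ^+ i * w ^+ i.+1 * power_sum (2 * i + 2) N
    - 2 * (-1) ^+ n * w ^+ n.+1 *
      \sum_(1 <= k < s.+1) (k%:R ^+ (2 * n) * (w + k%:R ^+ 2))^-1).
have ucvg : u @ \oo --> (-1) ^+ n * e.
  apply: cvgM; first exact: cvg_cst.
  apply: cvgB; last exact: cvg_cst.
  apply: cvgB; first exact: psi1_partial_cvg.
  apply: cvg_big => [|i _]; first exact: add_continuous.
  by apply: cvgM; [exact: cvg_cst|apply: power_sum_cvg; rewrite addn2].
have sgn : (-1) ^+ n * (-1) ^+ n = 1 :> R by rewrite -expr2 sqrr_sign.
have uE N : (s <= N)%N -> u N = 2 * w ^+ n.+1 * tail_sum w n s N.
  move=> sN; rewrite /u (@psi1_partial_expand _ _ n w0).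
  rewrite [\sum_(1 <= k < N.+1) _](@big_cat_nat _ _ _ s.+1) //=.
  rewrite -/(tail_sum w n s N).
  set S1 := \sum_(0 <= i < n) _; set S2 := \sum_(1 <= k < s.+1) _.
  transitivity (((-1) ^+ n * (-1) ^+ n) * (2 * w ^+ n.+1 * tail_sum w n s N)).
    by ring.
  by rewrite sgn mul1r.
have wn : 0 <= 2 * w ^+ n.+1 by rewrite mulr_ge0 // exprn_ge0.
apply/andP; split.
  apply: (ler_cvg_to (cvg_cst 0) ucvg); near=> N.
  rewrite uE; last by near: N; exact: nbhs_infty_ge.
  rewrite mulr_ge0 // sumr_ge0 // => k _.
  by rewrite invr_ge0 mulr_ge0 ?exprn_ge0 // addr_ge0 // exprn_ge0.
have vcvg : (fun N => 2 * w ^+ n.+1 *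
       (power_sum (2 * n + 2) N - power_sum (2 * n + 2) s)) @ \oo -->
    2 * w ^+ n.+1 *
      (zeta ((2 * n + 2)%:R : R) - power_sum (2 * n + 2) s).
  apply: cvgM; first exact: cvg_cst.
  by apply: cvgB; [apply: power_sum_cvg; rewrite addn2|exact: cvg_cst].
apply: (ler_cvg_to ucvg vcvg); near=> N.
have sN : (s <= N)%N by near: N; exact: nbhs_infty_ge.
rewrite uE // ler_wpM2l // {1}/power_sum (@big_cat_nat _ _ _ s.+1) //=.
rewrite -/(power_sum _ s) addrAC subrr add0r; apply: ler_sum_nat => k /andP[k1 _].
have k0 : 0 < k%:R :> R by rewrite ltr0n (leq_trans _ k1).
rewrite lef_pV2 ?posrE ?exprn_gt0 ?mulr_gt0 ?ltr_wpDl ?exprn_gt0 //.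
by rewrite exprD ler_pM2l ?exprn_gt0 // lerDr.
Unshelve. all: by end_near. Qed.
End Psi1.

(** * Uniqueness of power series coefficients *)

Section PowerSeries.
Variable R : realType.
Implicit Types (z : R) (c : R^nat).

Lemma pseriesS c z N : pseries c z N.+1 = pseries c z N + c N * z ^+ N.
Proof. by rewrite /pseries /series /= big_nat_recr. Qed.

(** At p t, with p inside the interval of convergence and t small, all terms
    after the first nonzero one add up to at most a constant times t^(n+1), since
    the numbers c_k p^k are bounded; so c_n p^n t^n is itself O(t^(n+1)). *)
Lemma pseries_eq0 c (r : R) : 0 < r ->
  (forall z, `|z| < r -> pseries c z @ \oo --> (0 : R)) -> forall n, c n = 0.
Proof.
move=> r0 cvg0; pose p := r / 2.
have p0 : 0 < p by rewrite divr_gt0.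
have cp := cvg0 p; have : cvgn (pseries c p).
  apply/cvg_ex; exists 0; apply: cp.
  by rewrite gtr0_norm // /p; lra.
move=> /cvg_series_cvg_0 t0.
have /cvg_seq_bounded/pinfty_ex_gt0[M M0 cM'] : cvgn (fun k => c k * p ^+ k).
  by apply/cvg_ex; exists 0.
have {cM'} cM k : `|c k * p ^+ k| <= M by exact: cM'.
move=> n; elim/ltn_ind: n => n IH.
suff H t : 0 < t <= 2^-1 -> `|c n * p ^+ n| <= 2 * M * t.
  have pn : p ^+ n != 0 by rewrite expf_neq0 // gt_eqF.
  apply/eqP; rewrite -(mulIr_eq0 _ (mulIf pn)) -normr_eq0; apply/eqP.
  set a := `|_| in H *; apply/eqP; rewrite eq_le normr_ge0 andbT leNgt; apply/negP => a0.
  have a1 : a <= M by exact: cM.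
  have := H (a / (4 * M)).
  rewrite divr_gt0 ?mulr_gt0 // ler_pdivrMr ?mulr_gt0 //=.
  have -> : 2 * M * (a / (4 * M)) = a / 2 by field; rewrite gt_eqF.
  have -> : 2^-1 * (4 * M) = 2 * M by field.
  have -> : a <= 2 * M by lra.
  by move=> /(_ isT); lra.
move=> /andP[t0' t1].
have tN m : `|pseries c (p * t) (n.+1 + m)%N - c n * p ^+ n * t ^+ n| <=
   2 * M * t ^+ n.+1 * (1 - t ^+ m).
  elim: m => [|m IHm].
    rewrite addn0 expr0 subrr mulr0 /pseries /series /= big_nat_recr //=.
    rewrite big_nat_cond big1 ?add0r => [|k /andP[/andP[_ kn] _]]; last first.
      by rewrite IH // mul0r.
    by rewrite exprMn mulrA subrr normr0.
  rewrite addnS pseriesS addrAC.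
  apply: le_trans (ler_normD _ _) _.
  apply: le_trans (lerD IHm (_ : _ <= M * t ^+ (n.+1 + m))) _.
    rewrite exprMn mulrA normrM ler_pM // ger0_norm // exprn_ge0 // ltW //.
  have : 0 <= M * (t ^+ n.+1 * t ^+ m) * (1 - 2 * t).
    have tge0 := ltW t0'; apply: mulr_ge0; last by lra.
    by apply: mulr_ge0; [exact: ltW|apply: mulr_ge0; exact: exprn_ge0].
  rewrite exprD (exprSr t m) -[in X in _ -> X]subr_ge0.
  by congr (0 <= _); ring.
have tp : 0 <= t ^+ n.+1 by rewrite exprn_ge0 // ltW.
have tN' N : (n < N)%N -> `|pseries c (p * t) N - c n * p ^+ n * t ^+ n| <=
   2 * M * t ^+ n.+1.
  move=> nN; rewrite -(subnKC nN); apply: le_trans (tN _) _.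
  rewrite ler_piMr // ?mulr_ge0 ?(ltW M0) //.
  by rewrite gerBl exprn_ge0 // ltW.
have : `|0 - c n * p ^+ n * t ^+ n| <= 2 * M * t ^+ n.+1.
  have pt : `|p * t| < r by rewrite gtr0_norm ?mulr_gt0 // /p; nra.
  apply: (ler_cvg_to (cvg_norm (cvgB (cvg0 _ pt) (cvg_cst _))) (cvg_cst _)).
  by near=> N; apply: tN'; near: N; exact: nbhs_infty_gt.
rewrite sub0r normrN normrM [X in _ * X]ger0_norm ?exprn_ge0 ?(ltW t0') //.
by rewrite exprS mulrA ler_pM2r // exprn_gt0.
Unshelve. all: by end_near. Qed.

Lemma pseries_inj (c1 c2 : R^nat) (r : R) (f : R -> R) : 0 < r ->
  (forall z, `|z| < r -> pseries c1 z @ \oo --> f z) ->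
  (forall z, `|z| < r -> pseries c2 z @ \oo --> f z) -> c1 = c2.
Proof.
move=> r0 h1 h2; apply/funext => n; apply/eqP; rewrite -subr_eq0; apply/eqP.
apply: (pseries_eq0 (c := fun n => c1 n - c2 n) r0) => z zr.
rewrite -(subrr (f z)).
have -> : pseries (fun n => c1 n - c2 n) z = (fun N => pseries c1 z N - pseries c2 z N).
  apply/funext => N; rewrite /pseries /series /= -sumrB.
  by apply: eq_bigr => k _; rewrite mulrBl.
by apply: cvgB; [exact: h1|exact: h2].
Qed.
End PowerSeries.

(** * Bernoulli numbers as zeta values *)

Section Bernoulli.
Variable R : realType.
Implicit Types (z : R) (k n s N : nat).

(** The coefficients B_k / k! of psi1, by Euler's formula
    B_{2i+2} / (2i+2)! = 2 (-1)^i zeta(2i+2) / (2 pi)^{2i+2}. *)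
Definition bernoulli_coef k : R :=
  if k == 0%N then 1 else if k == 1%N then - 2^-1 else
  if odd k then 0
  else 2 * (-1) ^+ k./2.-1 * (zeta (k%:R : R) / (2 * pi) ^+ k).

Let twopi_gt0 : 0 < 2 * pi :> R. Proof. by rewrite mulr_gt0 // pi_gt0. Qed.

Lemma pseries_bernoulli_coef z N :
  pseries bernoulli_coef z N.+2 = 1 - z / 2 +
  \sum_(0 <= i < N.+1./2) 2 * (-1) ^+ i * ((z / (2 * pi)) ^+ 2) ^+ i.+1 *
        zeta ((2 * i + 2)%:R : R).
Proof.
elim: N => [|N IH].
  rewrite /pseries /series /= big_nat_recr //= big_nat1 big_geq // addr0.
  by rewrite /bernoulli_coef /= mul1r expr1; ring.
rewrite pseriesS IH -addrA; congr (_ + _).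
have [oN|eN] := boolP (odd N.+2).
  have -> : bernoulli_coef N.+2 = 0 by rewrite /bernoulli_coef oN.
  rewrite mul0r addr0; congr (\sum_(0 <= i < _) _).
  by move: oN; lia.
have NE : N = N./2.*2 by lia.
have -> : N.+1./2 = N./2 by lia.
have -> : N.+2./2 = N./2.+1 by [].
rewrite big_nat_recr //=; congr (_ + _).
rewrite /bernoulli_coef (negPf eN) /=.
have -> : (2 * N./2 + 2)%N = N.+2 by lia.
rewrite -exprM; have -> : (2 * N./2.+1)%N = N.+2 by lia.
by rewrite expr_div_n; move: (_ ^+ N.+2)^-1 => u; ring.
Qed.

Lemma zeta_le2 p : (1 < p)%N -> zeta (p%:R : R) <= 2.
Proof.
move=> p1; apply: (ler_cvg_to (power_sum_cvg p1) (cvg_cst (2 : R))).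
by apply: nearW => N; exact: power_sum_le2.
Qed.

(** For |z| < 2pi the remainder [psi1_rem] with s = 0 is at most
    4 |z / 2pi|^(2n+2), which tends to 0. *)
Lemma bernoulli_coef_cvg z : `|z| < 2 * pi ->
  pseries bernoulli_coef z @ \oo --> psi1 z.
Proof.
move=> zpi; set w := (z / (2 * pi)) ^+ 2.
pose q := `|z / (2 * pi)|.
have q1 : `|q| < 1.
  by rewrite normr_id normrM normfV (gtr0_norm twopi_gt0) ltr_pdivrMr // mul1r.
rewrite -(cvg_shiftn 2%N); apply/cvgrPdist_le => e e0.
have /cvgrPdist_le/(_ e e0) : 4 * q ^+ N @[N --> \oo] --> (4 * 0 : R).
  by apply: cvgM; [exact: cvg_cst|exact: cvg_expr].
apply: filterS => N; rewrite mulr0 sub0r normrN => qN.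
rewrite /= addn2 pseries_bernoulli_coef.
have := psi1_remainder_bounds N.+1./2 0 z; set n := N.+1./2.
have nil (F : nat -> R) : \sum_(1 <= k < 1) F k = 0 by rewrite big_geq.
rewrite /psi1_rem /power_sum !nil mulr0 !subr0.
set S := \sum_(0 <= i < n) _.
have -> : psi1 z + z / 2 - 1 - S = psi1 z - (1 - z / 2 + S) by ring.
move=> /andP[h0 h1]; rewrite -(normrMsign n) (ger0_norm h0).
apply: (le_trans h1); apply: le_trans qN.
have -> : ((z / (2 * pi)) ^+ 2) ^+ n.+1 = q ^+ (2 * n.+1).
  by rewrite exprM real_normK ?num_real.
have q0 : 0 <= q by exact: normr_ge0.
rewrite ger0_norm; last by rewrite mulr_ge0 // exprn_ge0.
have qq : q ^+ (2 * n.+1) <= q ^+ N.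
  rewrite ler_wiXn2l // /n; [|lia].
  by move: q1; rewrite ger0_norm // => /ltW.
have z2 : zeta ((2 * n + 2)%:R : R) <= 2 by apply: zeta_le2; lia.
have := exprn_ge0 (2 * n.+1) q0.
move: (_ ^+ _) (_ ^+ N) (zeta _) qq z2 => u v y; nra.
Qed.

Lemma bernoulli_numE k : bernoulli_num k / k`!%:R = bernoulli_coef k.
Proof.
set B := [set B : R^nat | forall z, `|z| < 2 * pi ->
    pseries (fun k => B k / k`!%:R) z @ \oo --> psi1 z].
have kf i : i`!%:R != 0 :> R by rewrite pnatr_eq0 -lt0n fact_gt0.
have Bex : B (fun k => bernoulli_coef k * k`!%:R).
  move=> z zpi; have -> : (fun k => bernoulli_coef k * k`!%:R / k`!%:R) = bernoulli_coef.
    by apply/funext => i; rewrite mulfK.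
  exact: bernoulli_coef_cvg.
have Bnum : B bernoulli_num by apply: xgetPex; exists (fun k => bernoulli_coef k * k`!%:R).
have := pseries_inj twopi_gt0 Bnum bernoulli_coef_cvg.
by move=> /(congr1 (fun u => u k)).
Qed.

Lemma eps_rem_bounds n s z :
  0 <= (-1) ^+ n * eps_rem n s z <=
    2 * (z / (2 * pi)) ^+ (2 * n.+1) *
      (zeta ((2 * n + 2)%:R : R) -
       \sum_(1 <= k < s.+1) (k%:R ^+ (2 * n + 2))^-1).
Proof.
have -> : eps_rem n s z = psi1_rem n s z.
  rewrite /eps_rem /psi1_rem /r_rat exprM; congr (_ - _).
  rewrite /p_trunc opprD addrA; congr (_ - _); first by field.
  apply: eq_big_nat => i _; rewrite bernoulli_numE.
  rewrite (_ : (2 * i.+1)%R = (2 * i.+1)%N) //.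
  have -> : (2 * i.+1)%N = i.*2.+2 by lia.
  have -> : (2 * i + 2)%N = i.*2.+2 by lia.
  rewrite /bernoulli_coef /= negbK odd_double doubleK.
  rewrite -exprM (_ : (2 * i.+1)%N = i.*2.+2); last by lia.
  by rewrite expr_div_n; move: (_ ^+ i.*2.+2)^-1 => u; ring.
by rewrite exprM; exact: psi1_remainder_bounds.
Qed.
End Bernoulli.

(** * Polynomial approximation of the inverse on an interval *)

(** On [-1, 1] the best approximation of 1 / (c - x), for c = (q + 1/q) / 2 > 1, is
    explicit. With T_n the Chebyshev polynomials, the polynomial
      Q_N = T_{N+1} - 2q T_N + q^2 T_{N-1}
    satisfies |Q_N(x)| <= 1 - 2qx + q^2 = 2q (c - x) on [-1, 1]. Dividing
    1 - Q_N / Q_N(c) by c - x therefore gives a polynomial of degree N that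
    differs from 1 / (c - x) by at most 2q / Q_N(c). *)

Section BestInverseApproximation.
Variable R : realType.
Implicit Types (q x t a : R) (n N : nat).

(** The polynomial Q_n, generated by the Chebyshev recurrence in n; the first two
    values come from T_{-1} = T_1 = X and T_0 = 1. *)
Fixpoint cheb_residual q n : {poly R} :=
  match n with
  | 0 => (1 + q ^+ 2) *: 'X - (2 * q)%:P
  | n'.+1 => match n' with
    | 0 => 2 *: 'X ^+ 2 - (2 * q) *: 'X + (q ^+ 2 - 1)%:P
    | n''.+1 => 2 *: ('X * cheb_residual q n') - cheb_residual q n''
    end
  end.

Lemma cheb_residualS q n : cheb_residual q n.+2 =
  2 *: ('X * cheb_residual q n.+1) - cheb_residual q n.
Proof. by []. Qed.

Lemma nat_two_step_ind (T : nat -> Prop) :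
  T 0%N -> T 1%N -> (forall n, T n -> T n.+1 -> T n.+2) -> forall n, T n.
Proof.
move=> T0 T1 TS n; suff [] : T n /\ T n.+1 by [].
by elim: n => [|n [Tn Tn1]]; split=> //; apply: TS.
Qed.

Lemma size_cheb_residual q n : (size (cheb_residual q n) <= n.+2)%N.
Proof.
elim/nat_two_step_ind: n => [||n IH0 IH1].
- apply: leq_trans (size_polyD _ _) _; rewrite size_polyN geq_max.
  rewrite (leq_trans (size_scale_leq _ _)) ?size_polyX //=.
  by rewrite (leq_trans (size_polyC_leq1 _)).
- apply: leq_trans (size_polyD _ _) _; rewrite geq_max.
  rewrite (leq_trans (size_polyC_leq1 _)) // andbT.
  apply: leq_trans (size_polyD _ _) _; rewrite size_polyN geq_max.
  rewrite (leq_trans (size_scale_leq _ _)) ?size_polyXn //=.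
  by rewrite (leq_trans (size_scale_leq _ _)) ?size_polyX.
- rewrite cheb_residualS; move: (cheb_residual q n.+1) IH1 => B IH1.
  apply: leq_trans (size_polyD _ _) _; rewrite size_polyN geq_max.
  apply/andP; split; last by apply: leq_trans IH0 _; rewrite ltnW.
  apply: leq_trans (size_scale_leq _ _) _; rewrite mulrC.
  by have [->|nz] := eqVneq B 0; rewrite ?mul0r ?size_poly0 // size_mulX.
Qed.

Lemma cheb_residual_cos q n t : (cheb_residual q n).[cos t] =
  cos (n%:R * t) * ((1 + q ^+ 2) * cos t - 2 * q) -
  sin (n%:R * t) * (sin t * (1 - q ^+ 2)).
Proof.
elim/nat_two_step_ind: n => [||n IH0 IH1].
- by rewrite /= mul0r cos0 sin0 !hornerE subr0.
- rewrite mulr1n mul1r.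
  rewrite /= !(hornerD, hornerN, hornerZ, hornerX, hornerXn, hornerC).
  have : sin t ^+ 2 = 1 - cos t ^+ 2 by rewrite -(cos2Dsin2 t); ring.
  move: (cos t) (sin t) => c s E.
  by rewrite [s * (s * _)]mulrA -expr2 E; ring.
- rewrite cheb_residualS hornerD hornerN hornerZ hornerM hornerX IH0 IH1.
  have cE : cos (n.+2%:R * t) = 2 * cos t * cos (n.+1%:R * t) - cos (n%:R * t).
    have -> : n.+2%:R * t = n.+1%:R * t + t by rewrite [in LHS]mulrS; ring.
    have -> : n%:R * t = n.+1%:R * t - t by rewrite [in RHS]mulrS; ring.
    by rewrite cosD cosB; ring.
  have sE : sin (n.+2%:R * t) = 2 * cos t * sin (n.+1%:R * t) - sin (n%:R * t).
    have -> : n.+2%:R * t = n.+1%:R * t + t by rewrite [in LHS]mulrS; ring.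
    have -> : n%:R * t = n.+1%:R * t - t by rewrite [in RHS]mulrS; ring.
    by rewrite sinD sinB; ring.
  by rewrite cE sE; ring.
Qed.

(** For x = cos t, Q_n(x) is the real part of e^{int} times the complex number
    with parts u = (1 + q^2) x - 2q and v = (1 - q^2) sin t, whose modulus is
    1 - 2qx + q^2. *)
Lemma cheb_residual_le q n x : 0 <= q <= 1 -> -1 <= x <= 1 ->
  `|(cheb_residual q n).[x]| <= 1 - 2 * q * x + q ^+ 2.
Proof.
move=> /andP[q0 q1] xI; have /andP[x1 x2] := xI.
rewrite -(acosK xI) cheb_residual_cos.
have := cos2Dsin2 (acos x); have := cos2Dsin2 (n%:R * acos x).
rewrite acosK //; move: (sin _) (cos _) (sin _) => s c' s' E1 E2.
have pos : 0 <= 1 - 2 * q * x + q ^+ 2.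
  have : 0 <= (1 - q) ^+ 2 + 2 * q * (1 - x).
    by rewrite addr_ge0 ?sqr_ge0 // !mulr_ge0 // subr_ge0.
  by congr (_ <= _); ring.
rewrite -(@ler_pXn2r _ 2) ?nnegrE // real_normK ?num_real //.
pose u := (1 + q ^+ 2) * x - 2 * q; pose v := s * (1 - q ^+ 2).
have -> : (1 - 2 * q * x + q ^+ 2) ^+ 2 = (c' ^+ 2 + s' ^+ 2) * (u ^+ 2 + v ^+ 2).
  have s2 : s ^+ 2 = 1 - x ^+ 2 by rewrite -E2; ring.
  by rewrite E1 mul1r /v exprMn s2 /u; ring.
rewrite -/u -/v -subr_ge0.
have -> : (c' ^+ 2 + s' ^+ 2) * (u ^+ 2 + v ^+ 2) - (c' * u - s' * v) ^+ 2
  = (c' * v + s' * u) ^+ 2 by ring.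
exact: sqr_ge0.
Qed.

Lemma cheb_residual_pole q n : q != 0 ->
  (cheb_residual q n).[(q + q^-1) / 2] = (1 - q ^+ 2) ^+ 2 / 2 / q ^+ n.+1.
Proof.
move=> q0; elim/nat_two_step_ind: n => [||n IH0 IH1].
- by rewrite /= !(hornerD, hornerN, hornerZ, hornerX, hornerXn, hornerC); field.
- by rewrite /= !(hornerD, hornerN, hornerZ, hornerX, hornerXn, hornerC); field.
- rewrite cheb_residualS hornerD hornerN hornerZ hornerM hornerX IH0 IH1 !(exprS q).
  have qn : q ^+ n != 0 by rewrite expf_neq0.
  by field; rewrite qn.
Qed.

Lemma inv_poly_approx_pole q N : 0 < q < 1 ->
  exists p : {poly R}, (size p <= N.+1)%N /\
    forall x, -1 <= x <= 1 ->
     `| ((q + q^-1) / 2 - x)^-1 - p.[x] | <= 4 * q ^+ N.+2 / (1 - q ^+ 2) ^+ 2.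
Proof.
move=> /andP[q0 q1]; have qN0 := lt0r_neq0 q0.
pose c := (q + q^-1) / 2.
have q20 : 1 - q ^+ 2 != 0 by rewrite subr_eq0 eq_sym expr2 lt_eqF // mulr_ilt1 // ltW.
(* k is 1 / Q_N(c), so that 1 - k Q_N vanishes at c. *)
pose k := 2 * q ^+ N.+1 / (1 - q ^+ 2) ^+ 2.
have qN : q ^+ N != 0 by rewrite expf_neq0.
have rootc : root (1 - k *: cheb_residual q N) c.
  rewrite rootE hornerD hornerN hornerZ hornerC cheb_residual_pole //.
  rewrite /k exprS subr_eq0; apply/eqP.
  by field; rewrite qN qN0 q20.
have [g gE] := factor_theorem _ _ rootc.
have szg : (size g <= N.+1)%N.
  have [->|g0] := eqVneq g 0; first by rewrite size_poly0.
  have : size (g * ('X - c%:P)) = (size g).+1.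
    by rewrite size_Mmonic ?monicXsubC // size_XsubC addn2.
  rewrite -gE => E; rewrite -ltnS -E.
  apply: leq_trans (size_polyD _ _) _; rewrite size_polyN geq_max.
  rewrite (leq_trans (size_polyC_leq1 _)) //=.
  exact: leq_trans (size_scale_leq _ _) (size_cheb_residual _ _).
exists (- g); split=> [|x xI]; first by rewrite size_polyN.
have /andP[x1 x2] := xI.
have c1 : 1 < c.
  rewrite /c ltr_pdivlMr // mul1r -subr_gt0.
  have -> : q + q^-1 - 2 = (1 - q) ^+ 2 / q by field.
  by rewrite divr_gt0 // exprn_gt0 // subr_gt0.
have cx : 0 < c - x by rewrite subr_gt0 (le_lt_trans x2).
have -> : (c - x)^-1 - (- g).[x] = k * (cheb_residual q N).[x] / (c - x).
  have E : 1 - k * (cheb_residual q N).[x] = g.[x] * (x - c).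
    rewrite -(hornerXsubC c x) -hornerM -gE.
    by rewrite hornerD hornerN hornerZ hornerC.
  apply: (mulIf (lt0r_neq0 cx)); rewrite hornerN opprK mulrDl.
  rewrite divfK ?lt0r_neq0 // mulVf ?lt0r_neq0 //.
  have -> : g.[x] * (c - x) = - (g.[x] * (x - c)) by ring.
  by rewrite -E; ring.
rewrite normrM normfV (gtr0_norm cx) ler_pdivrMr // normrM.
have k0 : 0 <= k by rewrite /k divr_ge0 ?sqr_ge0 // mulr_ge0 // exprn_ge0 // ltW.
rewrite (ger0_norm k0).
apply: le_trans (ler_wpM2l k0 (cheb_residual_le N _ xI)) _; first by rewrite !ltW.
rewrite le_eqVlt; apply/orP; left; apply/eqP.
by rewrite /k /c !(exprS q); field; rewrite qN0 q20.
Qed.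

(** For t1 > 1 the affine change of variable t = h (c - x) maps [-1, 1] onto
    [a, a t1^2] when q = (t1 - 1) / (t1 + 1), and turns the previous bound into
    this one; for t1 = 1 the interval is a point. *)
Lemma inv_poly_approx a t1 N : 0 < a -> 1 <= t1 ->
  exists p : {poly R}, (size p <= N.+1)%N /\
    forall t, a <= t <= a * t1 ^+ 2 ->
     `| t^-1 - p.[t] | <=
       (1 + t1) ^+ 2 / (2 * a * t1 ^+ 2) * ((t1 - 1) / (t1 + 1)) ^+ N.+1.
Proof.
move=> a0; rewrite le_eqVlt => /predU1P[<-|t11].
  exists (a^-1)%:P; split; first by rewrite (leq_trans (size_polyC_leq1 _)).
  move=> t; rewrite expr1n mulr1 => /le_anti <-.
  by rewrite hornerC subrr normr0 subrr mul0r expr0n mulr0.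
have t10 : 0 < t1 by apply: lt_trans t11.
pose q := (t1 - 1) / (t1 + 1).
have q01 : 0 < q < 1.
  rewrite /q divr_gt0 ?subr_gt0 ?addr_gt0 //= ltr_pdivrMr ?addr_gt0 //.
  by rewrite mul1r; lra.
have [p [szp pE]] := inv_poly_approx_pole N q01.
pose h := a * (t1 ^+ 2 - 1) / 2.
have h0 : 0 < h.
  by rewrite /h divr_gt0 // mulr_gt0 // subr_gt0 exprn_egt1.
pose c := (q + q^-1) / 2.
have t1p : t1 + 1 != 0 by rewrite lt0r_neq0 // addr_gt0.
have t1m : t1 - 1 != 0 by rewrite subr_eq0 gt_eqF.
have tN0 := lt0r_neq0 t10; have aN0 := lt0r_neq0 a0; have hN0 := lt0r_neq0 h0.
have hc : h * (c - 1) = a by rewrite /h /c /q; field; rewrite t1p t1m.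
have hc' : h * (c + 1) = a * t1 ^+ 2 by rewrite /h /c /q; field; rewrite t1p t1m.
exists (h^-1 *: (p \Po (c%:P - h^-1 *: 'X))); split.
  apply: leq_trans (size_scale_leq _ _) _.
  apply: leq_trans (size_comp_poly_leq _ _) _; rewrite ltnS.
  have szl : (size (c%:P - h^-1 *: 'X)%R <= 2)%N.
    apply: leq_trans (size_polyD _ _) _; rewrite size_polyN geq_max.
    rewrite (leq_trans (size_polyC_leq1 _)) //=.
    by apply: leq_trans (size_scale_leq _ _) _; rewrite size_polyX.
  rewrite -[N]muln1 leq_mul //; first by case: (size p) szp.
  by case: (size _) szl.
move=> t /andP[ta tb].
have := pE (c - t / h).
rewrite hornerZ horner_comp hornerD hornerN hornerZ hornerC hornerX -/c.
rewrite (mulrC h^-1 t) => /(_ _)/wrap[].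
  have tE : t = h * (t / h) by rewrite mulrC divfK.
  move: ta tb; rewrite -hc' -{1}hc {1 2}tE !ler_pM2l // => ? ?.
  by apply/andP; split; lra.
have -> : c - (c - t / h) = t / h by ring.
have tP : 0 < t by apply: lt_le_trans ta.
move=> E; rewrite -(ler_pM2l h0) -[X in X * `|_|](ger0_norm (ltW h0)) -normrM mulrBr.
rewrite mulVKf //; rewrite invf_div in E.
apply: le_trans E _; rewrite le_eqVlt; apply/orP; left; apply/eqP.
have q2 : 1 - q ^+ 2 = 4 * t1 / (t1 + 1) ^+ 2 by rewrite /q; field.
rewrite q2 -/q (exprS q N.+1).
move: (q ^+ N.+1) => qq; rewrite /q /h; field.
by rewrite aN0 tN0 t1p.
Qed.
End BestInverseApproximation.

(** * Decay of the entries and the final estimates *)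

(** The hypothesis says that the row x - (M/2) e_j has Euclidean norm at most M/2.
    Hence M - 2 |x_nu| is nonnegative for nu <> j, while for nu = j it is at least
    - 2 |g_j| with g_j = x_j - M/2. The terms at j, n1 and n2 together are
    at least 2 (M - |g_j| - |x_n1| - |x_n2|) D_j, which is nonnegative: three
    numbers whose squares add up to at most M^2 / 4 have sum at most
    sqrt(3) M / 2. *)
Lemma row_weighted_sum_le (R : realFieldType) (I : finType) (j n1 n2 : I)
    (S : {pred I}) (x D : I -> R) (M : R) : 0 <= M ->
  \sum_nu (x nu - M / 2 *+ (nu == j)) ^+ 2 <= (M / 2) ^+ 2 ->
  uniq [:: j; n1; n2] -> {subset [:: j; n1; n2] <= S} ->
  (forall nu, nu \notin S -> x nu = 0) ->
  (forall nu, 0 <= D nu) -> D j <= D n1 -> D j <= D n2 ->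
  2 * \sum_nu `|x nu| * D nu <= M * \sum_(nu in S) D nu.
Proof.
move=> M0 x2 /= /and3P[]; rewrite !inE negb_or => /andP[j1 j2] n12 _ sub xS D0 D1 D2.
pose g nu := x nu - M / 2 *+ (nu == j).
have M2 : 0 <= M / 2 by rewrite divr_ge0.
have gE nu : nu != j -> g nu = x nu by rewrite /g => /negPf->; rewrite subr0.
have {}x2 : \sum_nu g nu ^+ 2 <= (M / 2) ^+ 2 by exact: x2.
have three : g j ^+ 2 + x n1 ^+ 2 + x n2 ^+ 2 <= (M / 2) ^+ 2.
  apply: le_trans x2; rewrite (bigD1 j) //= (bigD1 n1) 1?eq_sym //=.
  rewrite (bigD1 n2) /=; last by rewrite [n2 == j]eq_sym j2 eq_sym.
  rewrite (gE n1) 1?eq_sym // (gE n2) 1?eq_sym // !addrA lerDl sumr_ge0 //.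
  by move=> nu _; exact: sqr_ge0.
have offdiag nu : nu != j -> 0 <= M - 2 * `|x nu|.
  move=> nuj; have : `|x nu| <= M / 2.
    rewrite -(@ler_pXn2r _ 2) ?nnegrE // real_normK ?num_real //.
    apply: le_trans x2; rewrite (bigD1 nu) //= gE // lerDl sumr_ge0 //.
    by move=> k _; exact: sqr_ge0.
  lra.
rewrite (bigID (mem S)) /= [X in _ + X]big1 => [|nu /xS->]; last by rewrite normr0 mul0r.
rewrite addr0 -subr_ge0 !mulr_sumr -sumrB.
have jS := sub j; have n1S := sub n1; have n2S := sub n2.
rewrite !inE !eqxx ?orbT in jS n1S n2S.
rewrite (bigD1 j) ?jS //= (bigD1 n1) ?n1S 1?eq_sym //=.
rewrite (bigD1 n2) ?n2S //=; last by rewrite [n2 == j]eq_sym j2 eq_sym.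
set T := \sum_(_ | _) _.
have T0 : 0 <= T.
  apply: sumr_ge0 => nu /andP[/andP[/andP[_ nuj] _] _].
  by rewrite mulrA -mulrBl mulr_ge0 // offdiag.
have xj : `|x j| <= `|g j| + M / 2.
  have -> : x j = g j + M / 2 by rewrite /g eqxx mulr1n subrK.
  by apply: le_trans (ler_normD _ _) _; rewrite (ger0_norm M2).
have sum3 : `|g j| + `|x n1| + `|x n2| <= M.
  rewrite -(@ler_pXn2r _ 2) ?nnegrE ?addr_ge0 //.
  move: three; rewrite -(real_normK (num_real (g j))).
  rewrite -(real_normK (num_real (x n1))) -(real_normK (num_real (x n2))).
  move: `|g j| `|x n1| `|x n2| => a b c h.
  have := sqr_ge0 (a - b); have := sqr_ge0 (a - c); have := sqr_ge0 (b - c).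
  have := sqr_ge0 M. nra.
have h1 : (M - 2 * `|x n1|) * D j <= (M - 2 * `|x n1|) * D n1.
  by rewrite ler_wpM2l // offdiag // eq_sym.
have h2 : (M - 2 * `|x n2|) * D j <= (M - 2 * `|x n2|) * D n2.
  by rewrite ler_wpM2l // offdiag // eq_sym.
have h3 : 0 <= (M - `|g j| - `|x n1| - `|x n2|) * D j.
  by rewrite mulr_ge0 //; lra.
have h4 : (- 2 * `|g j|) * D j <= (M - 2 * `|x j|) * D j.
  by rewrite ler_wpM2r //; lra.
nra.
Qed.

Section InverseDecay.
Variables (R : realType) (d m : nat) (P : 'M[R]_d) (D : 'rV[R]_d).
Hypotheses (m0 : (0 < m)%N) (PPT : P *m P^T = 1%:M).
Let A := spectral_calculus P D id.
Hypothesis Aband : banded m A.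
Implicit Types (k : nat) (i j : 'I_d).

Lemma ratio_ge1 k : (0 < k)%N -> 1 <= Defs.ratio A k.
Proof.
move=> k0; have a0 : 0 < a_ R k by rewrite exprn_gt0 // ltr0n.
by rewrite /Defs.ratio ler_pdivlMr // mul1r lerDr sqr_ge0.
Qed.

Lemma sqrt_ratio_ge1 k : (0 < k)%N -> 1 <= Num.sqrt (Defs.ratio A k).
Proof. by move=> k0; rewrite -[leLHS]sqrtr1 ler_wsqrtr // ratio_ge1. Qed.

Let q k := (Num.sqrt (Defs.ratio A k) - 1) / (Num.sqrt (Defs.ratio A k) + 1).

Let q01 k : (0 < k)%N -> 0 <= q k <= 1.
Proof.
rewrite /q => /sqrt_ratio_ge1; move: (Num.sqrt _) => t t1.
have t0 : 0 < t + 1 by lra.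
by rewrite divr_ge0 ?subr_ge0 ?(ltW t0) //= ler_pdivrMr //; lra.
Qed.

(** This also covers q k = 0, which occurs when A = 0; estimates on powers of
    lambda are therefore derived from this identity rather than from laws of
    real exponents. *)
Lemma lambda_exp k : (0 < k)%N -> lambda_ A m k ^+ (2 * m) = q k.
Proof.
move=> k0; have /andP[q0 _] := q01 k0.
rewrite /lambda_ -/(q k) -powR_mulrn ?powR_ge0 // -powRrM mulVf ?powRr1 //.
by rewrite pnatr_eq0 muln_eq0 /= -lt0n.
Qed.

Lemma lambda_ge0 k : 0 <= lambda_ A m k.
Proof. exact: powR_ge0. Qed.

Lemma lambda_le1 k : (0 < k)%N -> lambda_ A m k <= 1.
Proof.
move=> k0; have /andP[q0 q1] := q01 k0.
have : lambda_ A m k ^+ (2 * m) <= 1 by rewrite lambda_exp.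
by rewrite expr_le1 ?lambda_ge0 // muln_gt0.
Qed.

Lemma C_ge0 k : 0 <= C_ A k.
Proof. by rewrite /C_ le_max invr_ge0 sqr_ge0. Qed.

Lemma shifted_square_range k l :
  a_ R k <= (D 0 l / (2 * pi)) ^+ 2 + k%:R ^+ 2 <= b_ A k.
Proof.
rewrite /a_ /b_ lerDr sqr_ge0 lerD2r /=.
rewrite !exprMn ler_wpM2r ?sqr_ge0 // -(real_normK (num_real (D 0 l))).
have h := eigenvalue_le_spectral_radius D PPT l.
by rewrite lerXn2r ?nnegrE // (le_trans _ h).
Qed.

(** Off the diagonal, at distance e, subtract from 1 / (w + k^2) a polynomial of
    degree N in w + k^2, where 2mN < e <= 2m (N+1): its matrix has a zero entry
    at (i, j), and the approximation error is C_k q^(N+1) <= C_k lambda_k^e. On the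
    diagonal the first member of the maximum defining C_k applies. *)
Lemma shifted_inverse_decay k i j : (0 < k)%N ->
  `|spectral_calculus P D
      (fun t => ((t / (2 * pi)) ^+ 2 + k%:R ^+ 2)^-1) i j| <=
    C_ A k * lambda_ A m k ^+ `|i - j|%N.
Proof.
move=> k0; set y := fun t : R => _.
have a0 : 0 < a_ R k by rewrite exprn_gt0 // ltr0n.
have [ij|] := eqVneq i j.
  rewrite ij distnn mulr1 le_max; apply/orP; left.
  apply: spectral_calculus_le => // l; have /andP[h _] := shifted_square_range k l.
  by rewrite ger0_norm ?invr_ge0 ?lef_pV2 ?posrE ?(le_trans (ltW a0) h) // (lt_le_trans a0).
rewrite -val_eqE -distn_eq0 -lt0n; set e := `|i - j|%N => e0.
pose N := (e.-1 %/ (2 * m))%N.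
have m20 : (0 < 2 * m)%N by rewrite muln_gt0.
(* N = ceil(e / 2m) - 1 is the largest degree that leaves the entry at distance
   e equal to zero. *)
have eN : (m * (2 * N) < e)%N.
  rewrite mulnCA mulnA mulnC -(prednK e0) ltnS; exact: leq_trunc_div.
have Ne : (e <= 2 * m * N.+1)%N.
  by rewrite -[leqLHS](prednK e0) mulnC ltn_ceil.
have [p [szp pE]] := inv_poly_approx N a0 (sqrt_ratio_ge1 k0).
pose p2 := p \Po ((2 * pi) ^- 2 *: 'X^2 + (k%:R ^+ 2)%:P).
have p2E t : p2.[t] = p.[(t / (2 * pi)) ^+ 2 + k%:R ^+ 2].
  rewrite horner_comp hornerD hornerZ hornerXn hornerC expr_div_n.
  by rewrite [(_ ^- 2) * _]mulrC.
have szp2 : (size p2 <= (2 * N).+1)%N.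
  apply: leq_trans (size_comp_poly_leq _ _) _; rewrite ltnS mulnC.
  have szl : (size ((2 * pi) ^- 2 *: 'X^2 + (k%:R ^+ 2)%:P : {poly R})%R <= 3)%N.
    apply: leq_trans (size_polyD _ _) _; rewrite geq_max.
    rewrite (leq_trans (size_scale_leq _ _)) ?size_polyXn //=.
    by rewrite (leq_trans (size_polyC_leq1 _)).
  by rewrite leq_mul //; [case: (size _) szl|case: (size p) szp].
have p2ij : spectral_calculus P D (horner p2) i j = 0.
  by rewrite (spectral_calculus_poly_banded PPT Aband szp2).
have -> : spectral_calculus P D y i j =
    spectral_calculus P D (y \+ (fun t => - 1 * p2.[t])) i j.
  by rewrite spectral_calculusD spectral_calculusZ [RHS]mxE [X in _ + X]mxE p2ij mulr0 addr0.
have bE : a_ R k * Num.sqrt (Defs.ratio A k) ^+ 2 = b_ A k.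
  rewrite sqr_sqrtr ?(le_trans ler01) ?ratio_ge1 // /Defs.ratio mulrC divfK //.
  by rewrite gt_eqF.
apply: le_trans (_ : _ <= C_ A k * q k ^+ N.+1) _.
  apply: le_trans (_ : _ <= (1 + Num.sqrt (Defs.ratio A k)) ^+ 2 /
      (2 * a_ R k * Defs.ratio A k) * q k ^+ N.+1) _.
    apply: spectral_calculus_le => // l /=; rewrite mulN1r p2E.
    have := pE ((D 0 l / (2 * pi)) ^+ 2 + k%:R ^+ 2).
    rewrite bE shifted_square_range => /(_ isT).
    by rewrite sqr_sqrtr // (le_trans ler01) ?ratio_ge1.
  have /andP[q0 _] := q01 k0.
  by rewrite ler_wpM2r ?exprn_ge0 // le_max lexx orbT.
rewrite ler_wpM2l ?C_ge0 // -lambda_exp // -exprM.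
by rewrite ler_wiXn2l ?lambda_ge0 ?lambda_le1.
Qed.
End InverseDecay.

Section Assembly.
Variables (R : realType) (d m : nat) (P : 'M[R]_d) (D : 'rV[R]_d).
Hypotheses (m0 : (0 < m)%N) (PPT : P *m P^T = 1%:M).
Let A := spectral_calculus P D id.
Hypothesis Aband : banded m A.
Implicit Types (k n s : nat) (i j : 'I_d).

Let pi2_gt0 : 0 < 2 * pi :> R. Proof. by rewrite mulr_gt0 // pi_gt0. Qed.

Lemma scaled_eigenvalue_exp_le n l :
  0 <= (D 0 l / (2 * pi)) ^+ (2 * n) <=
    spectral_norm ((2 * pi)^-1 *: A) ^+ (2 * n).
Proof.
rewrite exprM exprn_ge0 ?sqr_ge0 //= -exprM.
have := eigenvalue_le_spectral_norm ((2 * pi)^-1 *: D) PPT l.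
have -> : spectral_calculus P ((2 * pi)^-1 *: D) id = (2 * pi)^-1 *: A.
  rewrite -spectral_calculusZ /spectral_calculus; congr (_ *m diag_mx _ *m _).
  by apply/rowP => k; rewrite !mxE.
rewrite mxE mulrC => h.
have -> : (D 0 l / (2 * pi)) ^+ (2 * n) = `|D 0 l / (2 * pi)| ^+ (2 * n).
  by rewrite !exprM real_normK ?num_real.
by rewrite lerXn2r ?nnegrE // (le_trans _ h).
Qed.

Lemma p_trunc_banded n : (0 < n)%N ->
  banded (m * (2 * n)) (spectral_calculus P D (p_trunc n)).
Proof.
move=> n0; pose c (i : nat) : R := bernoulli_num (2 * i.+1) / (2 * i.+1)`!%:R.
pose p : {poly R} := 1 - 2^-1 *: 'X + \sum_(0 <= i < n) c i *: 'X^(2 * i.+1).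
have -> : p_trunc n = horner p.
  apply/funext => z; rewrite /p /p_trunc !(hornerD, hornerN, hornerZ, hornerX, hornerC).
  rewrite horner_sum; congr (_ + _); apply: eq_bigr => i _.
  by rewrite hornerZ hornerXn mulrC.
apply: spectral_calculus_poly_banded => //.
apply: leq_trans (size_polyD _ _) _; rewrite geq_max; apply/andP; split.
  apply: leq_trans (size_polyD _ _) _; rewrite size_polyN geq_max size_poly1 /=.
  by apply: leq_trans (size_scale_leq _ _) _; rewrite size_polyX; lia.
apply: leq_trans (size_sum _ _ _) _; apply/bigmax_leqP_seq => i.
rewrite mem_index_iota => /andP[_ ni] _.
by apply: leq_trans (size_scale_leq _ _) _; rewrite size_polyXn; lia.
Qed.

Lemma eps_rem_entry_le n s i j : i != j ->
  `|spectral_calculus P D (eps_rem n s) i j| <=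
    spectral_norm ((2 * pi)^-1 *: A) ^+ (2 * n.+1) *
    (zeta ((2 * n + 2)%:R : R) - \sum_(1 <= k < s.+1) (k%:R ^+ (2 * n + 2))^-1).
Proof.
move=> ij; set Z := _ - _; set M := _ ^+ _.
have Z0 : 0 <= Z.
  (* At z = 2 pi the power of z / 2pi is 1. *)
  have /andP[h1 h2] := eps_rem_bounds n s (2 * pi : R).
  have := le_trans h1 h2; rewrite divff ?gt_eqF // expr1n mulr1 -/Z; lra.
have -> : spectral_calculus P D (eps_rem n s) i j =
    (-1) ^+ n * spectral_calculus P D (fun t => (-1) ^+ n * eps_rem n s t) i j.
  by rewrite spectral_calculusZ [in RHS]mxE mulrA -expr2 sqrr_sign mul1r.
rewrite normrMsign.
have -> : M * Z = (2 * M * Z) / 2 by field.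
apply: spectral_calculus_offdiag_le => // l.
have /andP[-> /= h] := eps_rem_bounds n s (D 0 l).
apply: le_trans h _; rewrite -/Z ler_wpM2r // ler_pM2l //.
by have /andP[] := scaled_eigenvalue_exp_le n.+1 l.
Qed.

Let decay n s i nu : R :=
  \sum_(1 <= k < s.+1) C_ A k / k%:R ^+ (2 * n) * lambda_ A m k ^+ `|i - nu|%N.

Let decay_ge0 n s i nu : 0 <= decay n s i nu.
Proof.
rewrite sumr_ge0 // => k _.
by rewrite mulr_ge0 ?exprn_ge0 ?lambda_ge0 // mulr_ge0 ?C_ge0 // invr_ge0 exprn_ge0.
Qed.

Let decay_le n s i nu1 nu2 : (`|i - nu2| <= `|i - nu1|)%N ->
  decay n s i nu1 <= decay n s i nu2.
Proof.
move=> h; apply: ler_sum_nat => k /andP[k1 _].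
rewrite ler_wpM2l //; first by rewrite mulr_ge0 ?C_ge0 // invr_ge0 exprn_ge0.
by rewrite ler_wiXn2l ?lambda_ge0 ?lambda_le1.
Qed.

(* The two neighbours of j on the side of i. *)
Let two_closer i j : (2 < `|i - j|)%N -> exists n1 n2 : 'I_d,
  [/\ uniq [:: j; n1; n2],
      (`|j - n1| <= 2)%N /\ (`|j - n2| <= 2)%N,
      (`|i - n1| <= `|i - j|)%N & (`|i - n2| <= `|i - j|)%N].
Proof.
move=> hij; have [ji|ij] := leqP j i.
  have h1 : (j.+1 < d)%N by have := ltn_ord i; lia.
  have h2 : (j.+2 < d)%N by have := ltn_ord i; lia.
  exists (Ordinal h1), (Ordinal h2); rewrite /= !inE -!val_eqE /=.
  by split; [lia|split; lia|lia|lia].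
have h1 : (j.-1 < d)%N by have := ltn_ord j; lia.
have h2 : (j.-2 < d)%N by have := ltn_ord j; lia.
exists (Ordinal h1), (Ordinal h2); rewrite /= !inE -!val_eqE /=.
by split; [lia|split; lia|lia|lia].
Qed.

(** By symmetry the entry is read at (j, i), as row j of X = (A / 2pi)^{2(n+1)}
    times column i of the sum of inverses; the decay bounds of the latter serve as
    the weights in [row_weighted_sum_le]. *)
Lemma r_rat_entry_le n s i j : (2 < `|i - j|)%N ->
  `|spectral_calculus P D (r_rat n s) i j| <=
    spectral_norm ((2 * pi)^-1 *: A) ^+ (2 * n.+1) *
    \sum_(nu < d | (j <= nu + 2 * m * n.+1)%N && (nu <= j + 2 * m * n.+1)%N)
      decay n s i nu.
Proof.
move=> hij; set M := _ ^+ _.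
pose X t : R := (t / (2 * pi)) ^+ (2 * n.+1).
pose Y t : R := \sum_(1 <= k < s.+1)
    (k%:R ^+ (2 * n) * ((t / (2 * pi)) ^+ 2 + k%:R ^+ 2))^-1.
have XM l : 0 <= X (D 0 l) <= M by exact: scaled_eigenvalue_exp_le.
have M0 : 0 <= M by have /andP[h1 h2] := XM i; exact: le_trans h1 h2.
have rE : r_rat n s = (fun t => 2 * (-1) ^+ n * (X \* Y) t).
  by apply/funext => t; rewrite /r_rat mulrA.
have YE nu : spectral_calculus P D Y nu i = \sum_(1 <= k < s.+1)
   (k%:R ^+ (2 * n))^-1 * spectral_calculus P D
      (fun t => ((t / (2 * pi)) ^+ 2 + k%:R ^+ 2)^-1) i nu.
  rewrite spectral_calculus_sym spectral_calculusE.
  under eq_bigr do rewrite mulr_sumr mulr_suml.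
  rewrite exchange_big /=; apply: eq_bigr => k _.
  rewrite spectral_calculusE mulr_sumr; apply: eq_bigr => l _.
  by rewrite invfM mulrCA !mulrA.
have Yle nu : `|spectral_calculus P D Y nu i| <= decay n s i nu.
  rewrite YE; apply: le_trans (ler_norm_sum _ _ _) _.
  apply: ler_sum_nat => k /andP[k0 _]; rewrite normrM [leRHS]mulrAC [leRHS]mulrC.
  rewrite ger0_norm ?invr_ge0 ?exprn_ge0 // ler_wpM2l ?invr_ge0 ?exprn_ge0 //.
  exact: shifted_inverse_decay.
rewrite spectral_calculus_sym rE spectral_calculusZ spectral_calculusM //.
rewrite 2!mxE normrM normrM normr_sign mulr1 ger0_norm //.
apply: le_trans (_ : _ <= 2 * \sum_nu `|spectral_calculus P D X j nu| * decay n s i nu) _.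
  rewrite ler_pM2l //; apply: le_trans (ler_norm_sum _ _ _) _.
  by apply: ler_sum => nu _; rewrite normrM ler_wpM2l.
have [n1 [n2 [unq [w1 w2] c1 c2]]] := two_closer hij.
have mn : (2 <= 2 * m * n.+1)%N by rewrite -mulnA leq_pmulr // muln_gt0 m0.
apply: (row_weighted_sum_le (n1 := n1) (n2 := n2) (j := j)) => //.
- have -> : \sum_nu (spectral_calculus P D X j nu - M / 2 *+ (nu == j)) ^+ 2 =
    \sum_nu spectral_calculus P D (X \+ (fun=> - (M / 2))) j nu ^+ 2.
    apply: eq_bigr => nu _; rewrite spectral_calculusD spectral_calculus_cst //.
    by rewrite [in RHS]mxE [X in _ = (_ + X) ^+ _]mxE mulNrn eq_sym.
  apply: spectral_calculus_row_sqr => // l /=.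
  by rewrite ler_norml; have /andP[h1 h2] := XM l; apply/andP; split; lra.
- move=> nu; rewrite !inE => /or3P[] /eqP ->; rewrite /in_mem /=; lia.
- move=> nu; rewrite /in_mem /= => hnu.
  have -> : X = horner ((2 * pi) ^- (2 * n.+1) *: 'X^(2 * n.+1)).
    by apply/funext => t; rewrite hornerZ hornerXn /X expr_div_n mulrC.
  rewrite (spectral_calculus_poly_banded (K := 2 * n.+1) PPT Aband) //.
    by apply: leq_trans (size_scale_leq _ _) _; rewrite size_polyXn.
  by rewrite mulnA (mulnC m); lia.
- exact: decay_le.
- exact: decay_le.
Qed.

End Assembly.

Theorem theorem3 (R : realType) (d m : nat) (A : 'M[R]_d)
  (hm : (1 <= m)%N) (Asym : A^T = A) (Aband : banded m A)
  (n s : nat) (hn : (1 <= n)%N) (i j : 'I_d) (hij : (2 * m * n < `|i - j|)%N) :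
  [/\ `|mxfun (@psi1 R) A i j| <=
        `|mxfun (r_rat n s) A i j| + `|mxfun (eps_rem n s) A i j|,
      `|mxfun (r_rat n s) A i j| <=
        spectral_norm ((2 * pi)^-1 *: A) ^+ (2 * n.+1) *
        \sum_(nu < d | (j <= nu + 2 * m * n.+1)%N &&
                       (nu <= j + 2 * m * n.+1)%N)
          \sum_(1 <= k < s.+1)
            C_ A k / k%:R ^+ (2 * n) * lambda_ A m k ^+ `|i - nu|%N &
      `|mxfun (eps_rem n s) A i j| <=
        spectral_norm ((2 * pi)^-1 *: A) ^+ (2 * n.+1) *
        (zeta ((2 * n + 2)%:R : R) -
         \sum_(1 <= k < s.+1) (k%:R ^+ (2 * n + 2))^-1)].
Proof.
have [P [D [PPT AE]]] := symmetric_orthogonal_diagonalization Asym.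
have {AE}AE : A = spectral_calculus P D id by rewrite AE /spectral_calculus map_mx_id.
rewrite {Asym}AE in Aband *; rewrite !mxfun_spectral_calculus //.
have h2 : (2 <= 2 * m * n)%N by rewrite -mulnA leq_pmulr // muln_gt0 hm.
split.
- have -> : @psi1 R = (p_trunc n \+ r_rat n s) \+ eps_rem n s.
    by apply/funext => z; rewrite /eps_rem /=; ring.
  have -> : spectral_calculus P D ((p_trunc n \+ r_rat n s) \+ eps_rem n s) i j =
      spectral_calculus P D (r_rat n s) i j +
      spectral_calculus P D (eps_rem n s) i j.
    rewrite spectral_calculusD (spectral_calculusD P D (p_trunc n)).
    rewrite [LHS]mxE [X in X + _ = _]mxE.
    by rewrite (p_trunc_banded hm PPT Aband hn) ?add0r // mulnCA mulnA.
  exact: ler_normD.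
- by apply: r_rat_entry_le => //; exact: leq_ltn_trans hij.
- apply: eps_rem_entry_le => //; apply: contraTneq hij => ->.
  by rewrite distnn.
Qed.
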